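(* Let $\xi$ be a random vector with distribution $P$ whose support $\Xi\subset\mathbb{R}^l$ is compact and convex, let $\mathcal Y$ be the space of measurable functions on $\Xi$, $A\in\mathbb{R}^{n\times n}$, $q_1\in\mathbb{R}^n$, and $B:\mathbb{R}^l\to\mathbb{R}^{n\times m}$, $M:\mathbb{R}^l\to\mathbb{R}^{m\times m}$, $N:\mathbb{R}^l\to\mathbb{R}^{m\times n}$, $q_2:\mathbb{R}^l\to\mathbb{R}^m$ continuous. Suppose there is a positive continuous function $\kappa$ with $\mathbb{E}[\kappa(\xi)]<+\infty$ such that for almost every $\xi$, $\begin{pmatrix} z^T & u^T\end{pmatrix}\begin{pmatrix} A & B(\xi)\\ N(\xi) & M(\xi)\end{pmatrix}\begin{pmatrix} z\\ u\end{pmatrix}\ge\kappa(\xi)(\|z\|^2+\|u\|^2)$ for all $z\in\mathbb{R}^n,u\in\mathbb{R}^m$. For each $K$, let $\{\Xi_1^K,\dots,\Xi_K^K\}$ be a partition of $\Xi$ into compact convex sets with pairwise disjoint interiors and $\bigcup_i\Xi_i^K=\Xi$; set $p_i^K=P(\Xi_i^K)$ and $\mathbb{E}_{\Xi_i^K}[H(\xi)]=\frac{1}{p_i^K}\int_{\Xi_i^K}H(\xi)P(d\xi)$. Consider the discretized problem: find $(x,\mathbf y_1,\dots,\mathbf y_K)$ with $$0\le x\perp Ax+\sum_{i=1}^Kp_i^K\mathbb{E}_{\Xi_i^K}[B(\xi)]\mathbf y_i+q_1\ge0,\qquad 0\le\mathbf y_i\perp\mathbb{E}_{\Xi_i^K}[M(\xi)]\mathbf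 y_i+\mathbb{E}_{\Xi_i^K}[N(\xi)]x+\mathbb{E}_{\Xi_i^K}[q_2(\xi)]\ge0,\ i=1,\dots,K.$$ Then: (i) the discretized problem has a unique solution $(x^K,\mathbf y^K)=(x^K,\mathbf y_1^K,\dots,\mathbf y_K^K)$. Set $y^K(\xi)=\sum_{i=1}^K\mathbf y_i^K\mathbf 1_{\Xi_i^K}(\xi)$. If in addition $\max_{i}\Delta(\Xi_i^K)\to0$ as $K\to\infty$, where $\Delta(S)=\max_{\xi_1,\xi_2\in S}\|\xi_1-\xi_2\|$, then: (ii) $\{(x^K,y^K(\cdot))\}$ is bounded in $\mathbb{R}^n\times\mathcal Y$, boundedness of $y^K(\cdot)$ being in the norm of $\mathcal L_1$; (iii) $(x^K,y^K(\cdot))$ converges to the unique solution $(x^*,y^*(\cdot))$ of the two-stage SLCP $$0\le x\perp Ax+\mathbb{E}[B(\xi)y(\xi)]+q_1\ge 0,\qquad 0\le y(\xi)\perp M(\xi)y(\xi)+N(\xi)x+q_2(\xi)\ge0\ \text{ for a.e. }\xi\in\Xi,$$ where the convergence $y^K(\cdot)\to y^*(\cdot)$ is in the norm of $\mathcal L_2$.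
   Context: $\mathbf 1_S$ is the indicator function of $S$. ''$0\le a\perp b\ge 0$'' means $a\ge0$, $b\ge0$, $a^Tb=0$. Expectations are componentwise.
   Formalization: The partition is additionally required to have distinct cells meeting in P-null sets (the claim fails if P has an atom on a common cell boundary) and every cell to have p_i^K > 0 (otherwise the conditional expectation is undefined). *)

(* Defs.v *)
From HB Require Import structures.
From mathcomp Require Import all_boot all_order all_algebra.
From mathcomp Require Import all_classical all_reals all_analysis.
Set Implicit Arguments. Unset Strict Implicit. Unset Printing Implicit Defensive.
Import Order.TTheory GRing.Theory Num.Theory.
Import numFieldNormedType.Exports.
Local Open Scope classical_set_scope.
Local Open Scope ring_scope.

Definition borelRV (R : realType) (l : nat) :=
  g_sigma_algebraType (@open 'rV[R]_l).

Definition sqnorm (R : realType) (k : nat) (v : 'cV[R]_k) : R :=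
  \sum_(i < k) v i 0 ^+ 2.
Definition enorm (R : realType) (k : nat) (v : 'cV[R]_k) : R :=
  Num.sqrt (sqnorm v).
Definition enormr (R : realType) (k : nat) (v : 'rV[R]_k) : R :=
  Num.sqrt (\sum_(i < k) v 0 i ^+ 2).

Definition diam (R : realType) (l : nat) (S : set 'rV[R]_l) : R :=
  sup [set enormr (a - b) | a in S & b in S].

Definition supp (R : realType) (l : nat) (P : probability (borelRV R l) R)
  : set 'rV[R]_l :=
  [set x | forall e : R, 0 < e -> (0 < P (ball x e))%E].

Definition compl (R : realType) (k : nat) (a b : 'cV[R]_k) : Prop :=
  (forall i, 0 <= a i 0) /\ (forall i, 0 <= b i 0) /\ (a^T *m b) 0 0 = 0.

Definition mxint (R : realType) (l : nat) (P : probability (borelRV R l) R)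
  (S : set 'rV[R]_l) (p q : nat) (H : 'rV[R]_l -> 'M[R]_(p, q)) : 'M[R]_(p, q) :=
  \matrix_(a, b) fine (\int[P]_(x in S) (H x a b)%:E).

Definition condE (R : realType) (l : nat) (P : probability (borelRV R l) R)
  (S : set 'rV[R]_l) (p q : nat) (H : 'rV[R]_l -> 'M[R]_(p, q)) : 'M[R]_(p, q) :=
  (fine (P S))^-1 *: mxint P S H.

Definition disc_sol (R : realType) (n m l K : nat) (P : probability (borelRV R l) R)
  (A : 'M[R]_n) (q1 : 'cV[R]_n) (B : 'rV[R]_l -> 'M[R]_(n, m))
  (M : 'rV[R]_l -> 'M[R]_m) (N : 'rV[R]_l -> 'M[R]_(m, n))
  (q2 : 'rV[R]_l -> 'cV[R]_m) (Xs : 'I_K -> set 'rV[R]_l)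
  (x : 'cV[R]_n) (ys : 'I_K -> 'cV[R]_m) : Prop :=
  compl x (A *m x + \sum_(i < K) fine (P (Xs i)) *: (condE P (Xs i) B *m ys i) + q1)
  /\ forall i : 'I_K,
     compl (ys i) (condE P (Xs i) M *m ys i + condE P (Xs i) N *m x
                   + condE P (Xs i) q2).

(* The two-stage SLCP: y is a measurable (Borel) function R^l -> R^m such that
   B(xi) y(xi) is integrable (so that E[B(xi) y(xi)] is defined). *)
Definition slcp_sol (R : realType) (n m l : nat) (P : probability (borelRV R l) R)
  (A : 'M[R]_n) (q1 : 'cV[R]_n) (B : 'rV[R]_l -> 'M[R]_(n, m))
  (M : 'rV[R]_l -> 'M[R]_m) (N : 'rV[R]_l -> 'M[R]_(m, n))
  (q2 : 'rV[R]_l -> 'cV[R]_m) (x : 'cV[R]_n) (y : 'rV[R]_l -> 'cV[R]_m) : Prop :=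
  (forall a : 'I_m, measurable_fun setT (fun xi : borelRV R l => y xi a 0))
  /\ (forall a : 'I_n,
        P.-integrable setT (fun xi : borelRV R l => ((B xi *m y xi) a 0)%:E))
  /\ compl x (A *m x + mxint P setT (fun xi => B xi *m y xi) + q1)
  /\ {ae P, forall xi : borelRV R l, compl (y xi) (M xi *m y xi + N xi *m x + q2 xi)}.

(* Main.v *)
Require Import Defs.
From HB Require Import structures.
From mathcomp Require Import all_boot all_order all_algebra.
From mathcomp Require Import all_classical all_reals all_analysis.
From mathcomp Require Import measurable_realfun.
From mathcomp Require Import ring lra.
Set Implicit Arguments. Unset Strict Implicit. Unset Printing Implicit Defensive.
Import Order.TTheory GRing.Theory Num.Theory.
Import numFieldNormedType.Exports.
Local Open Scope classical_set_scope.
Local Open Scope ring_scope.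

(* Eliminating the second stage: for fixed x and xi, strong monotonicity makes
   the inner LCP uniquely solvable, with a solution Lipschitz in x and continuous
   in xi on the support. The reduced first-stage map x |-> A x + E[B y(x)] + q1
   is then strongly monotone and Lipschitz on R^n, so that the projected step
   x |-> (x - t F x)^+ is a contraction for small t. The same argument, with
   cell averages as data and a finite sum as expectation, solves the discretized
   problem.
   Convergence: the a priori bounds on (x^K, y^K_i) do not depend on K, and
   sum_i p_i E_i[B] y_i = E[B y^K] holds exactly. Testing the complementarity
   conditions of both problems against each other and integrating therefore
   bounds |x^K - x*|^2 + E|y^K - y*|^2 by the squared oscillation of
   M, N, q2 over the cells, which vanishes by uniform continuity. *)

(** The estimates on solutions stay in squared norms and rely on [young] with weight [k]: a cross
    term then costs only half of the coercive term. Averages enter through the half-space property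
    [averages], so that one abstract argument serves points of the support and cells alike; testing
    an average against itself takes the place of Jensen's inequality. Two gaps are bridged
    beforehand: coercivity is given only almost everywhere, and with a varying [kappa]. Continuity
    extends it to every point of the support, and compactness provides a positive minimum [k] of
    [kappa] there. For fixed vectors the coercivity inequality is affine in the data, so cell
    averages inherit it with the same [k]; this is why the bounds do not depend on the partition.
    The instance below lets Banach's theorem be applied to column vectors. *)

HB.instance Definition _ (R : realType) (m n : nat) := Complete.on 'M[R]_(m, n).

(** * Euclidean estimates and complementarity *)

Section euclid.
Variable R : realType.
Implicit Types (n m : nat) (c k : R).

Definition dot n (u v : 'cV[R]_n) : R := \sum_i u i 0 * v i 0.

Lemma dotC n (u v : 'cV[R]_n) : dot u v = dot v u.
Proof. by apply: eq_bigr => i _; rewrite mulrC. Qed.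

Lemma dotDr n (u v w : 'cV[R]_n) : dot u (v + w) = dot u v + dot u w.
Proof. by rewrite -big_split; apply: eq_bigr => i _; rewrite mxE mulrDr. Qed.

Lemma dotDl n (u v w : 'cV[R]_n) : dot (v + w) u = dot v u + dot w u.
Proof. by rewrite dotC dotDr !(dotC u). Qed.

Lemma dotZr n c (u v : 'cV[R]_n) : dot u (c *: v) = c * dot u v.
Proof. by rewrite mulr_sumr; apply: eq_bigr => i _; rewrite mxE mulrCA. Qed.

Lemma dotZl n c (u v : 'cV[R]_n) : dot (c *: u) v = c * dot u v.
Proof. by rewrite dotC dotZr dotC. Qed.

Lemma dotNr n (u v : 'cV[R]_n) : dot u (- v) = - dot u v.
Proof. by rewrite -scaleN1r dotZr mulN1r. Qed.

Lemma dotNl n (u v : 'cV[R]_n) : dot (- u) v = - dot u v.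
Proof. by rewrite dotC dotNr dotC. Qed.

Lemma dotBr n (u v w : 'cV[R]_n) : dot u (v - w) = dot u v - dot u w.
Proof. by rewrite dotDr dotNr. Qed.

Lemma dotBl n (u v w : 'cV[R]_n) : dot (v - w) u = dot v u - dot w u.
Proof. by rewrite dotDl dotNl. Qed.

Lemma dot0l n (u : 'cV[R]_n) : dot 0 u = 0.
Proof. by rewrite -[0](scale0r u) dotZl mul0r. Qed.

Lemma dot_sumr n (I : finType) (u : 'cV[R]_n) (v : I -> 'cV[R]_n) :
  dot u (\sum_i v i) = \sum_i dot u (v i).
Proof.
rewrite exchange_big; apply: eq_bigr => j _.
by rewrite summxE mulr_sumr.
Qed.

Lemma sqnormE n (u : 'cV[R]_n) : sqnorm u = dot u u.
Proof. by apply: eq_bigr => i _; rewrite expr2. Qed.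

Lemma sqnorm0 n : sqnorm (0 : 'cV[R]_n) = 0.
Proof. by rewrite sqnormE dot0l. Qed.

Lemma sqnorm_ge0 n (u : 'cV[R]_n) : 0 <= sqnorm u.
Proof. by apply: sumr_ge0 => i _; exact: sqr_ge0. Qed.

Lemma sqnorm_entry n (u : 'cV[R]_n) i : u i 0 ^+ 2 <= sqnorm u.
Proof.
rewrite /sqnorm (bigD1 i)//= lerDl; apply: sumr_ge0 => j _; exact: sqr_ge0.
Qed.

Lemma sqnorm_le_card n (u : 'cV[R]_n) c :
  (forall i, u i 0 ^+ 2 <= c) -> sqnorm u <= n%:R * c.
Proof.
move=> h; apply: (@le_trans _ _ (\sum_(i < n) c)); first exact: ler_sum.
by rewrite sumr_const card_ord mulr_natl.
Qed.

Lemma sqnorm_eq0 n (u : 'cV[R]_n) : sqnorm u <= 0 -> u = 0.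
Proof.
move=> u0; apply/colP => i; rewrite mxE; apply/eqP.
by rewrite -sqrf_eq0 eq_le sqr_ge0 (le_trans (sqnorm_entry u i)).
Qed.

Lemma sqnormN n (u : 'cV[R]_n) : sqnorm (- u) = sqnorm u.
Proof. by rewrite !sqnormE dotNl dotNr opprK. Qed.

Lemma sqnormZ n c (u : 'cV[R]_n) : sqnorm (c *: u) = c ^+ 2 * sqnorm u.
Proof. by rewrite !sqnormE dotZr dotC dotZr mulrA expr2. Qed.

Lemma sqnormD n (u v : 'cV[R]_n) :
  sqnorm (u + v) = sqnorm u + 2 * dot u v + sqnorm v.
Proof. by rewrite !sqnormE dotDr !dotDl (dotC v u); ring. Qed.

Lemma sqnormD_le n (u v : 'cV[R]_n) :
  sqnorm (u + v) <= 2 * (sqnorm u + sqnorm v).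
Proof.
have := sqnorm_ge0 (u - v).
by rewrite !sqnormD sqnormN dotNr; lra.
Qed.

(** Expand the square of [k *: u - v] and divide by [2 * k]. The first term is half of what
    coercivity provides, so it can be absorbed. *)
Lemma young n k (u v : 'cV[R]_n) : 0 < k ->
  dot u v <= k / 2 * sqnorm u + (2 * k)^-1 * sqnorm v.
Proof.
move=> k0; have := sqnorm_ge0 (k *: u - v).
rewrite sqnormD sqnormN dotNr sqnormZ dotZl => h; rewrite -(ler_pM2l (_ : 0 < 2 * k)) ?mulr_gt0//.
have -> : 2 * k * (k / 2 * sqnorm u + (2 * k)^-1 * sqnorm v)
          = k ^+ 2 * sqnorm u + sqnorm v.
  by field; rewrite gt_eqF.
by lra.
Qed.

(** The vector tested is |v|^2 times the component of [u] orthogonal to [v]. Its squared norm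
    carries a factor |v|^2 to be cancelled, whence the separate case [v = 0]. *)
Lemma cauchy_schwarz n (u v : 'cV[R]_n) : dot u v ^+ 2 <= sqnorm u * sqnorm v.
Proof.
have [v0|v0] := eqVneq (sqnorm v) 0.
  have -> : v = 0 by apply: sqnorm_eq0; rewrite v0.
  rewrite /dot big1 ?expr0n ?mulr_ge0 ?sqnorm_ge0//.
  by move=> i _; rewrite mxE mulr0.
have vp : 0 < sqnorm v by rewrite lt_def v0 sqnorm_ge0.
have := sqnorm_ge0 (sqnorm v *: u - dot u v *: v).
rewrite sqnormD sqnormN dotNr !sqnormZ dotZr dotZl.
set a := sqnorm u; set b := sqnorm v in vp *; set d := dot u v => h.
rewrite -(ler_pM2l vp).
have : 0 <= b * (a * b - d ^+ 2) by move: h; lra.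
by rewrite pmulr_rge0//; move=> ?; rewrite ler_pM2l//; lra.
Qed.

(** Squared Frobenius norm, to pair with [sqnorm]. *)
Definition frob m n (M : 'M[R]_(m, n)) : R := \sum_i \sum_j M i j ^+ 2.

Lemma frob_ge0 m n (M : 'M[R]_(m, n)) : 0 <= frob M.
Proof. by apply: sumr_ge0 => i _; apply: sumr_ge0 => j _; exact: sqr_ge0. Qed.

Lemma frob_le_card m n (M : 'M[R]_(m, n)) c :
  (forall i j, M i j ^+ 2 <= c) -> frob M <= (m * n)%:R * c.
Proof.
move=> h; apply: (@le_trans _ _ (\sum_(i < m) \sum_(j < n) c)).
  by apply: ler_sum => i _; apply: ler_sum => j _.
by rewrite !sumr_const !card_ord -mulrnA mulnC mulr_natl.
Qed.

Lemma sqnorm_mulmx_le m n (M : 'M[R]_(m, n)) (u : 'cV[R]_n) :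
  sqnorm (M *m u) <= frob M * sqnorm u.
Proof.
rewrite mulr_suml; apply: ler_sum => i _.
rewrite (_ : (M *m u) i 0 = dot (row i M)^T u); last first.
  by rewrite mxE; apply: eq_bigr => j _; rewrite !mxE.
apply: le_trans (cauchy_schwarz _ _) _.
rewrite ler_wpM2r ?sqnorm_ge0//.
by apply: ler_sum => j _; rewrite !mxE.
Qed.

Lemma compl_dot n (u v : 'cV[R]_n) : compl u v -> dot u v = 0.
Proof.
by case=> _ [_]; rewrite mxE => <-; apply: eq_bigr => i _; rewrite mxE.
Qed.

(** The diagonal products vanish, and the two cross products, of nonnegative vectors, enter with a
    minus sign. Every comparison of two solutions below starts here. *)
Lemma compl_monotone n (u v u' v' : 'cV[R]_n) :
  compl u v -> compl u' v' -> dot (u - u') (v - v') <= 0.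
Proof.
move=> c c'; rewrite dotBr !dotBl (compl_dot c) (compl_dot c').
have h a b a' b' : @compl R n a b -> compl a' b' -> 0 <= dot a b'.
  by case=> a0 _ [_ [b0 _]]; apply: sumr_ge0 => i _; rewrite mulr_ge0.
by have := h _ _ _ _ c c'; have := h _ _ _ _ c' c; lra.
Qed.

Lemma compl00 n : compl (0 : 'cV[R]_n) 0.
Proof. by split; [|split]; rewrite ?mulmx0; move=> *; rewrite !mxE. Qed.

End euclid.

(** * Strongly monotone complementarity problems *)

Section ncp.
Variables (R : realType) (n : nat).
Implicit Types x y : 'cV[R]_n.

Let pos x : 'cV[R]_n := \col_i Num.max 0 (x i 0).

(** The projection onto the orthant acts coordinatewise, and [Num.max 0] is 1-Lipschitz. *)
Let sqnorm_pos_le x y : sqnorm (pos x - pos y) <= sqnorm (x - y).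
Proof.
apply: ler_sum => i _; rewrite !mxE.
have [a0|a0] := leP 0 (x i 0); have [b0|b0] := leP 0 (y i 0) => //.
- by rewrite !expr2; nra.
- by rewrite !expr2; nra.
- by rewrite subrr expr0n sqr_ge0.
Qed.

Lemma sqnorm_le_norm x : sqnorm x <= n%:R * `|x| ^+ 2.
Proof.
apply: sqnorm_le_card => i; rewrite -real_normK ?num_real// lerXn2r ?nnegrE//.
rewrite [leRHS]/Num.norm/= mx_normrE.
by apply/bigmax_geP; right; exists (i, 0).
Qed.

Lemma norm_sqr_le_sqnorm x : `|x| ^+ 2 <= sqnorm x.
Proof.
have [->|x0] := eqVneq x 0; first by rewrite normr0 expr0n sqnorm_ge0.
have : mx_norm x != 0 by apply: contra_neq x0 => /mx_norm_eq0.
move=> /mx_norm_neq0[[i j]]; rewrite /= ord1 => nx.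
rewrite [X in X ^+ 2](_ : _ = `|x i 0|); last exact: nx.
by rewrite real_normK ?num_real// sqnorm_entry.
Qed.

(* The projected step is a contraction for [sqnorm], hence some iterate of it
   is one for the sup norm, in which the library states Banach's theorem. *)
Lemma contraction_fixpoint (T : 'cV[R]_n -> 'cV[R]_n) (c : R) :
  0 <= c < 1 ->
  (forall x y, sqnorm (T x - T y) <= c * sqnorm (x - y)) ->
  exists x, T x = x.
Proof.
move=> /andP[c0 c1] Tc.
have Tj j x y : sqnorm (iter j T x - iter j T y) <= c ^+ j * sqnorm (x - y).
  elim: j => [|j IH]; first by rewrite expr0 mul1r.
  by rewrite !iterS (le_trans (Tc _ _))// exprS -mulrA ler_wpM2l.
(* The factor [n%:R] is the price of passing between the Euclidean and the sup norm; the power of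
   [c] beats it and leaves ratio 1/2. *)
have [j cj] : exists j, c ^+ j * n%:R < 2^-1 ^+ 2.
  have : (fun j => c ^+ j * n%:R) @ \oo --> 0 * (n%:R : R).
    by apply: cvgMr_tmp; apply: cvg_expr; rewrite ger0_norm.
  rewrite mul0r => /cvgrPdist_lt/(_ (2^-1 ^+ 2)) h.
  have /h[N _ /(_ N (leqnn _))] : 0 < (2^-1 : R) ^+ 2 by rewrite exprn_gt0 ?invr_gt0.
  rewrite sub0r normrN ger0_norm => [hN|]; first by exists N.
  by rewrite mulr_ge0 ?exprn_ge0.
have Sj x y : `|iter j T x - iter j T y| <= 2^-1 * `|x - y|.
  rewrite -(@ler_pXn2r _ 2) ?nnegrE ?mulr_ge0 ?invr_ge0//.
  rewrite (le_trans (norm_sqr_le_sqnorm _))// (le_trans (Tj _ _ _))//.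
  rewrite (le_trans (ler_wpM2l (exprn_ge0 _ c0) (sqnorm_le_norm _)))//.
  by rewrite mulrA exprMn ler_wpM2r ?exprn_ge0// ltW.
pose U : set 'cV[R]_n := setT.
have fU : set_fun U U (iter j T) by [].
pose f : {fun U >-> U} := mkfun_fun fU.
have [|||x _ xf] := @banach_fixed_point R _ U f.
- have h0 : 0 <= (2^-1 : R) by rewrite invr_ge0.
  exists (NngNum h0); split => /=; first by rewrite invf_lt1 ?ltr1n.
  by move=> [x y] _ /=; exact: Sj.
- exact: closedT.
- by exists 0.
have {}xf : iter j T x = x by [].
(* [T] commutes with its iterates, so [T x] is also a fixed point of [iter j T]; the contraction
   forces it to equal [x]. *)
exists x; apply/eqP; rewrite -subr_eq0 -normr_le0.
have := Sj (T x) x; rewrite -iterSr iterS xf.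
by have := normr_ge0 (T x - x); lra.
Qed.

(** Solutions are the fixed points of the projected step. That step multiplies squared distances by
    at most 1 - 2tk + t^2 L, where [L] is the square of a Lipschitz constant. *)
Lemma ncp_exists (F : 'cV[R]_n -> 'cV[R]_n) (k L : R) : 0 < k -> 0 <= L ->
  (forall x y, k * sqnorm (x - y) <= dot (x - y) (F x - F y)) ->
  (forall x y, sqnorm (F x - F y) <= L * sqnorm (x - y)) ->
  exists x, compl x (F x).
Proof.
move=> k0 L0 Fmono Flip.
have D0 : 0 < L + k ^+ 2 by rewrite ltr_wpDl// exprn_gt0.
(* Adding [k ^+ 2] to the denominator covers [L = 0] and ensures [t * k <= 1]; since also
   [t * L <= k], the ratio is at most [1 - t * k], which is nonnegative. *)
pose t := k / (L + k ^+ 2).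
have t0 : 0 < t by rewrite divr_gt0.
have tD : t * L + t * k ^+ 2 = k by rewrite -mulrDr /t divfK// gt_eqF.
have tk1 : t * k <= 1.
  by rewrite /t mulrAC ler_pdivrMr// mul1r -expr2 lerDr.
have [||x xT] := @contraction_fixpoint (fun x => pos (x - t *: F x)) (1 - t * k).
- by apply/andP; split; [lra | have := mulr_gt0 t0 k0; lra].
- move=> x y; apply: le_trans (sqnorm_pos_le _ _) _.
  rewrite (_ : _ - _ = (x - y) - t *: (F x - F y)); last first.
    by rewrite scalerBr !opprB addrACA [RHS]addrACA [- y + _]addrC.
  rewrite sqnormD sqnormN dotNr sqnormZ dotZr.
  have h1 := Fmono x y; have h2 := Flip x y; have s0 := sqnorm_ge0 (x - y).
  set s := sqnorm (x - y) in h1 h2 s0 *; set p := dot _ _ in h1 *.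
  set f := sqnorm _ in h2 *.
  have h3 : t * (k * s) <= t * p by rewrite ler_pM2l.
  have h4 : t ^+ 2 * f <= t ^+ 2 * (L * s) by rewrite ler_pM2l ?exprn_gt0.
  have h5 : t ^+ 2 * (L * s) <= t * k * s.
    rewrite mulrA ler_wpM2r// expr2 -mulrA ler_pM2l//.
    have : 0 <= t * k ^+ 2 by rewrite mulr_ge0 ?exprn_ge0// ltW.
    by lra.
  by lra.
have xE i : x i 0 = Num.max 0 (x i 0 - t * F x i 0).
  by rewrite -{1}xT !mxE.
(* In each coordinate either the maximum is the step itself, and then [F x] vanishes there, or it is
   0, and then [x] vanishes and [F x] is positive. *)
have xF i : [/\ 0 <= x i 0, 0 <= F x i 0 & x i 0 * F x i 0 = 0].
  have := xE i; case: (leP 0 (x i 0 - t * F x i 0)) => h e.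
    have : t * F x i 0 = 0 by lra.
    move/eqP; rewrite mulf_eq0 gt_eqF//= => /eqP f0.
    by move: h; rewrite -e f0 mulr0.
  rewrite e mul0r; split => //.
  by move: h; rewrite e sub0r oppr_lt0 pmulr_rgt0// => /ltW.
exists x; split; [by move=> i; have [] := xF i|split].
  by move=> i; have [] := xF i.
by rewrite mxE big1// => i _; rewrite mxE; have [] := xF i.
Qed.

Lemma ncp_unique (F : 'cV[R]_n -> 'cV[R]_n) (k : R) : 0 < k ->
  (forall x y, k * sqnorm (x - y) <= dot (x - y) (F x - F y)) ->
  forall x y, compl x (F x) -> compl y (F y) -> x = y.
Proof.
move=> k0 Fmono x y cx cy; apply/eqP; rewrite -subr_eq0; apply/eqP/sqnorm_eq0.
by rewrite -(pmulr_rle0 _ k0) (le_trans (Fmono _ _))// compl_monotone.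
Qed.

End ncp.

Section lcp.
Variables (R : realType) (m : nat) (k : R).
Hypothesis k0 : 0 < k.
Implicit Types (M : 'M[R]_m) (r y u : 'cV[R]_m).

Definition coercive M := forall u, k * sqnorm u <= dot u (M *m u).

(** Testing the two problems against each other leaves [M *m (y - y')] plus the defect of the data
    at [y']; coercivity of [M] and Young's inequality finish. Nothing is asked of [M']. Uniqueness,
    the a priori bound, Lipschitz dependence on [x] and continuity in the parameter are all
    instances. *)
Lemma lcp_stab M M' r r' y y' : coercive M ->
  compl y (M *m y + r) -> compl y' (M' *m y' + r') ->
  k ^+ 2 * sqnorm (y - y') <= sqnorm ((M - M') *m y' + (r - r')).
Proof.
move=> cM c c'; have := compl_monotone c c'.
set e := _ + (r - r'); have -> : M *m y + r - (M' *m y' + r') = M *m (y - y') + e.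
  by rewrite /e mulmxBl mulmxBr opprD addrACA -!addrA; congr (_ + _); rewrite addKr.
rewrite dotDr => h; have := young (y - y') (- e) k0.
rewrite dotNr sqnormN => h2; have h3 := cM (y - y').
have : k / 2 * sqnorm (y - y') <= (2 * k)^-1 * sqnorm e by lra.
rewrite -(ler_pM2l (_ : 0 < 2 * k)) ?mulr_gt0//.
rewrite [leRHS]mulrA mulfV ?mul1r ?gt_eqF ?mulr_gt0//.
by apply: le_trans; rewrite le_eqVlt; apply/orP; left; apply/eqP; field.
Qed.

(** A total function of the data, so that the recourse is defined off the support too; where
    coercivity fails its value is 0 or an arbitrary solution. *)
Definition lcp_map M r : 'cV[R]_m := xget 0 [set y | compl y (M *m y + r)].

Lemma lcp_mapP M r : coercive M -> compl (lcp_map M r) (M *m lcp_map M r + r).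
Proof.
move=> cM; rewrite /lcp_map; case: xgetP => [y ->//|].
have [y cy /(_ y)//] : exists y, compl y (M *m y + r).
apply: (@ncp_exists _ _ _ k (frob M) k0 (frob_ge0 M)) => x y.
  by rewrite opprD addrACA subrr addr0 -mulmxBr cM.
by rewrite opprD addrACA subrr addr0 -mulmxBr sqnorm_mulmx_le.
Qed.

Lemma lcp_map_unique M r y : coercive M -> compl y (M *m y + r) -> y = lcp_map M r.
Proof.
move=> cM cy; apply/eqP; rewrite -subr_eq0; apply/eqP/sqnorm_eq0.
rewrite -(pmulr_rle0 _ (exprn_gt0 2 k0)).
rewrite (le_trans (lcp_stab cM cy (lcp_mapP _ cM)))// !subrr mul0mx addr0.
by rewrite sqnorm0.
Qed.

(** The reference problem has zero matrix and zero vector and is solved by 0. *)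
Lemma lcp_bound M r y : coercive M -> compl y (M *m y + r) ->
  k ^+ 2 * sqnorm y <= sqnorm r.
Proof.
move=> cM cy; have c0 : compl (0 : 'cV_m) ((0 : 'M[R]_m) *m 0 + 0).
  by rewrite mulmx0 addr0; exact: compl00.
by have := lcp_stab cM cy c0; rewrite !subr0 mulmx0 add0r.
Qed.

End lcp.

(** * Reduction to the first stage *)

Section two_stage.
Variables (R : realType) (n m : nat) (T : Type) (S : set T) (k b : R).
Variables (A : 'M[R]_n) (q1 : 'cV[R]_n) (B : T -> 'M[R]_(n, m)).
Variables (M : T -> 'M[R]_m) (N : T -> 'M[R]_(m, n)) (q2 : T -> 'cV[R]_m).
Hypothesis k0 : 0 < k.
Hypothesis b0 : 0 <= b.
Hypothesis Bb : forall t, S t -> frob (B t) <= b.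
Hypothesis Nb : forall t, S t -> frob (N t) <= b.
Hypothesis coer : forall t, S t -> forall z u,
  k * (sqnorm z + sqnorm u) <=
  dot z (A *m z + B t *m u) + dot u (N t *m z + M t *m u).

Lemma coercive_diag t : S t -> coercive k (M t).
Proof.
move=> /coer /(_ 0) h u; have := h u.
by rewrite !mulmx0 !add0r dot0l sqnorm0 !add0r.
Qed.

(** [t] ranges over an abstract type: points of the support with the original data, or cell indices
    with averaged data. *)
Definition recourse (x : 'cV[R]_n) t := lcp_map (M t) (N t *m x + q2 t).

Lemma recourseP x t : S t ->
  compl (recourse x t) (M t *m recourse x t + N t *m x + q2 t).
Proof. by move=> St; rewrite -addrA; apply/lcp_mapP/coercive_diag. Qed.

Lemma recourse_unique x t y : S t ->
  compl y (M t *m y + N t *m x + q2 t) -> y = recourse x t.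
Proof. by move=> St; rewrite -addrA; apply/lcp_map_unique/coercive_diag. Qed.

Lemma recourse_lip x x' t : S t ->
  k ^+ 2 * sqnorm (recourse x t - recourse x' t) <= b * sqnorm (x - x').
Proof.
move=> St; have cM := coercive_diag St.
apply: le_trans (lcp_stab k0 cM (lcp_mapP k0 (N t *m x + q2 t) cM)
  (lcp_mapP k0 (N t *m x' + q2 t) cM)) _.
rewrite subrr mul0mx add0r opprD addrACA subrr addr0 -mulmxBr.
by apply: le_trans (sqnorm_mulmx_le _ _) _; rewrite ler_wpM2r ?sqnorm_ge0// Nb.
Qed.

(* By Hahn-Banach, the hypothesis on [G] says that [G x - G x'] lies in the
   closed convex hull of the vectors [B t *m (recourse x t - recourse x' t)];
   both a weighted finite sum and an expectation are of this form. *)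
Definition averages (G : 'cV[R]_n -> 'cV[R]_n) := forall x x' z c,
  (forall t, S t -> c <= dot z (B t *m (recourse x t - recourse x' t))) ->
  c <= dot z (G x - G x').

Variable G : 'cV[R]_n -> 'cV[R]_n.
Hypothesis Gavg : averages G.
Let F x := A *m x + G x + q1.

Let FB x x' : F x - F x' = A *m (x - x') + (G x - G x').
Proof. by rewrite /F opprD addrACA subrr addr0 opprD addrACA mulmxBr. Qed.

(** By [averages] a bound at each [t] suffices. There second-stage complementarity makes the [N],
    [M] part of the quadratic form nonpositive, so coercivity falls entirely on the [A], [B]
    part. *)
Lemma two_stage_mono x x' : k * sqnorm (x - x') <= dot (x - x') (F x - F x').
Proof.
rewrite FB dotDr -lerBlDl; apply: Gavg => t St.
set y := recourse x t; set y' := recourse x' t.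
have := compl_monotone (recourseP x St) (recourseP x' St).
rewrite -/y -/y' [X in dot _ X](_ : _ = N t *m (x - x') + M t *m (y - y')); last first.
  rewrite opprD addrACA subrr addr0 opprD addrACA -!mulmxBr.
  by rewrite addrC.
have := coer St (x - x') (y - y'); rewrite !dotDr.
by have := mulr_ge0 (ltW k0) (sqnorm_ge0 (y - y')); lra.
Qed.

(** The one-sided hypothesis is tested against [- w]: each [dot w v] is at most half of |w|^2 +
    |v|^2, so averaging bounds |w|^2 by the same expression and half of it is absorbed. *)
Let G_lip x x' : k ^+ 2 * sqnorm (G x - G x') <= b ^+ 2 * sqnorm (x - x').
Proof.
set w := G x - G x'; set s := sqnorm (x - x').
have k20 : 0 < k ^+ 2 by rewrite exprn_gt0.
suff : - (2^-1 * (sqnorm w + b ^+ 2 / k ^+ 2 * s)) <= dot (- w) w.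
  rewrite dotNl -sqnormE => h.
  have {h} : sqnorm w <= b ^+ 2 / k ^+ 2 * s by lra.
  by rewrite mulrAC ler_pdivlMr// mulrC.
apply: Gavg => t St; rewrite dotNl lerN2.
set v := B t *m _; have := young w v ltr01.
suff : sqnorm v <= b ^+ 2 / k ^+ 2 * s by rewrite mulr1; lra.
apply: le_trans (sqnorm_mulmx_le _ _) _.
have h := recourse_lip x x' St.
apply: (@le_trans _ _ (b * sqnorm (recourse x t - recourse x' t))).
  by rewrite ler_wpM2r ?sqnorm_ge0 ?Bb.
rewrite -(ler_pM2l k20) mulrCA (_ : _ * (_ * s) = b * (b * s)).
  by rewrite ler_wpM2l.
by field; rewrite gt_eqF.
Qed.

Lemma two_stage_exists : exists x, compl x (F x).
Proof.
have k20 : 0 < k ^+ 2 by rewrite exprn_gt0.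
apply: (@ncp_exists _ _ F k (2 * (frob A + b ^+ 2 / k ^+ 2)) k0).
- by rewrite mulr_ge0// addr_ge0 ?frob_ge0// divr_ge0 ?exprn_ge0// ltW.
- exact: two_stage_mono.
move=> x x'; rewrite FB; apply: le_trans (sqnormD_le _ _) _.
rewrite -mulrA ler_pM2l// mulrDl lerD ?sqnorm_mulmx_le//.
by rewrite mulrAC ler_pdivlMr// mulrC G_lip.
Qed.

Lemma two_stage_unique x x' : compl x (F x) -> compl x' (F x') -> x = x'.
Proof. exact: ncp_unique k0 two_stage_mono _ _. Qed.

End two_stage.

(** Coercivity is applied to the solution itself. Complementarity turns both blocks of the form into
    terms in [q1] and [q2], which Young's inequality absorbs; [g] stands for any average of the
    vectors [B t *m y t]. *)
Lemma two_stage_bound (R : realType) n m (T : Type) (S : set T) (k c : R)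
  (A : 'M[R]_n) (q1 g x : 'cV[R]_n) (B : T -> 'M[R]_(n, m))
  (M : T -> 'M[R]_m) (N : T -> 'M[R]_(m, n)) (q2 : T -> 'cV[R]_m)
  (y : T -> 'cV[R]_m) : 0 < k ->
  (forall t, S t -> forall z u, k * (sqnorm z + sqnorm u) <=
    dot z (A *m z + B t *m u) + dot u (N t *m z + M t *m u)) ->
  (forall t, S t -> sqnorm (q2 t) <= c) ->
  (forall t, S t -> compl (y t) (M t *m y t + N t *m x + q2 t)) ->
  (forall z d, (forall t, S t -> d <= dot z (B t *m y t)) -> d <= dot z g) ->
  compl x (A *m x + g + q1) ->
  k ^+ 2 * sqnorm x <= c + sqnorm q1.
Proof.
move=> k0 coer q2c cy hg /compl_dot; rewrite !dotDr => cx.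
have {hg} : k * sqnorm x - dot x (A *m x) - (2 * k)^-1 * c <= dot x g.
  apply: hg => t St; have := coer t St x (y t).
  have := compl_dot (cy t St); rewrite !dotDr => e.
  have := young (y t) (- q2 t) k0; rewrite dotNr sqnormN.
  have : (2 * k)^-1 * sqnorm (q2 t) <= (2 * k)^-1 * c.
    by rewrite ler_pM2l ?q2c// invr_gt0 mulr_gt0.
  have := mulr_ge0 (ltW k0) (sqnorm_ge0 (y t)).
  by lra.
have := young x (- q1) k0; rewrite dotNr sqnormN => h1 h2.
have : k / 2 * sqnorm x <= (2 * k)^-1 * (c + sqnorm q1) by lra.
rewrite -(ler_pM2l (_ : 0 < 2 * k)) ?mulr_gt0//.
rewrite [leRHS]mulrA mulfV ?mul1r ?gt_eqF ?mulr_gt0//.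
by apply: le_trans; rewrite le_eqVlt; apply/orP; left; apply/eqP; field.
Qed.

(** * Integration of bounded measurable functions *)

Section bounded_measurable.
Context d (T : measurableType d) (R : realType) (P : probability T R).
Implicit Types (S : set T) (f g : T -> R).

(** Unlike integrability, this property is stable under products, and the integrands built from
    continuous data on a compact set have it. *)
Definition bounded_measurable S f :=
  measurable_fun S f /\ exists c, forall t, S t -> `|f t| <= c.

(* [filterS] itself finds no filter instance when the domain is displayed as
   ['rV[R]_l] instead of [borelRV R l]; these restatements fix the type. *)
Lemma ae_imply (Q Q' : T -> Prop) : (forall t, Q t -> Q' t) ->
  {ae P, forall t, Q t} -> {ae P, forall t, Q' t}.
Proof. by move=> QQ'; apply: filterS. Qed.

Lemma ae_imply2 (Q1 Q2 Q' : T -> Prop) : (forall t, Q1 t -> Q2 t -> Q' t) ->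
  {ae P, forall t, Q1 t} -> {ae P, forall t, Q2 t} -> {ae P, forall t, Q' t}.
Proof. by move=> QQ'; apply: filterS2. Qed.

Lemma ae_forall (I : finType) (Q : I -> T -> Prop) :
  (forall i, {ae P, forall t, Q i t}) -> {ae P, forall t, forall i, Q i t}.
Proof. by move=> hQ; exact: filter_forall. Qed.

Lemma bounded_measurable_cst S c : bounded_measurable S (cst c).
Proof. by split; [exact: measurable_cst | exists `|c|]. Qed.

Lemma bounded_measurableD S f g : bounded_measurable S f ->
  bounded_measurable S g -> bounded_measurable S (fun t => f t + g t).
Proof.
move=> [mf [a fa]] [mg [b gb]]; split; first exact: measurable_funD.
by exists (a + b) => t St; rewrite (le_trans (ler_normD _ _))// lerD ?fa ?gb.
Qed.

Lemma bounded_measurableM S f g : bounded_measurable S f ->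
  bounded_measurable S g -> bounded_measurable S (fun t => f t * g t).
Proof.
move=> [mf [a fa]] [mg [b gb]]; split; first exact: measurable_funM.
by exists (a * b) => t St; rewrite normrM ler_pM ?fa ?gb.
Qed.

Lemma bounded_measurable_sum S (I : finType) (f : I -> T -> R) :
  (forall i, bounded_measurable S (f i)) ->
  bounded_measurable S (fun t => \sum_i f i t).
Proof.
move=> bf; elim: (index_enum I) => [|i r ih].
  under eq_fun do rewrite big_nil.
  exact: bounded_measurable_cst.
by under eq_fun do rewrite big_cons; exact: bounded_measurableD.
Qed.

Lemma bounded_measurable_integrable S f : measurable S ->
  bounded_measurable S f -> P.-integrable S (EFin \o f).
Proof.
move=> mS [mf [c fc]]; apply: measurable_bounded_integrable => //.
  by rewrite (le_lt_trans (probability_le1 P mS)) ?ltry.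
exists c; split; first exact: num_real.
by move=> x cx t St; exact: le_trans (fc t St) (ltW cx).
Qed.

Lemma Rintegral_sum S (I : finType) (f : I -> T -> R) : measurable S ->
  (forall i, P.-integrable S (EFin \o f i)) ->
  \int[P]_(t in S) (\sum_i f i t) = \sum_i \int[P]_(t in S) f i t.
Proof.
move=> mS intf; elim: (index_enum I) => [|i r ih].
  rewrite big_nil; under eq_Rintegral do rewrite big_nil.
  by rewrite Rintegral_cst// mul0r.
rewrite big_cons -ih; under eq_Rintegral do rewrite big_cons.
rewrite RintegralD//.
have -> : EFin \o (fun t => \sum_(j <- r) f j t) =
    (fun t => \sum_(j <- r) (EFin \o f j) t)%E.
  by apply/funext => t /=; rewrite sumEFin.
exact: integrable_sum.
Qed.

Lemma le_Rintegral_ae S f g : measurable S ->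
  P.-integrable S (EFin \o f) -> P.-integrable S (EFin \o g) ->
  {ae P, forall t, S t -> f t <= g t} ->
  \int[P]_(t in S) f t <= \int[P]_(t in S) g t.
Proof.
move=> mS intf intg [N [mN N0 fgN]]; rewrite /Rintegral.
rewrite (negligible_integral mN mS intf N0) (negligible_integral mN mS intg N0).
apply: le_Rintegral; first exact: measurableD.
- by apply: integrableS intf => //; exact: measurableD.
- by apply: integrableS intg => //; exact: measurableD.
move=> t [St Nt]; apply: contrapT => h; apply/Nt/fgN => /(_ St).
exact: h.
Qed.

Lemma eq_Rintegral_ae S f g : measurable S ->
  P.-integrable S (EFin \o f) -> P.-integrable S (EFin \o g) ->
  {ae P, forall t, S t -> f t = g t} ->
  \int[P]_(t in S) f t = \int[P]_(t in S) g t.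
Proof.
move=> mS intf intg fg; apply/eqP; rewrite eq_le.
by apply/andP; split; apply: le_Rintegral_ae => //;
  apply: filterS fg => t + St => ->.
Qed.

End bounded_measurable.

Section matrix_integral.
Context (R : realType) (l : nat) (P : probability (borelRV R l) R).
Implicit Types S : set (borelRV R l).

Lemma mxint_mulmx S p q (H : 'rV[R]_l -> 'M[R]_(p, q)) (u : 'cV[R]_q) :
  measurable S ->
  (forall i j, P.-integrable S (fun t : borelRV R l => (H t i j)%:E)) ->
  mxint P S H *m u = mxint P S (fun t => H t *m u).
Proof.
move=> mS intH; apply/matrixP => i j; rewrite !mxE.
have e : forall t, (H t *m u) i j = \sum_k H t i k * u k j by move=> t; rewrite mxE.
rewrite -/(Rintegral P S (fun t => (H t *m u) i j)).
under [RHS]eq_Rintegral do rewrite e.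
rewrite Rintegral_sum//; last first.
  move=> k; have := @integrableZr _ _ _ P S mS (u k j) _ (intH i k).
  by apply: eq_integrable => // t _; rewrite /= EFinM.
by apply: eq_bigr => k _; rewrite mxE RintegralZr//; exact: intH.
Qed.

Lemma dot_mxint S p (h : 'rV[R]_l -> 'cV[R]_p) (z : 'cV[R]_p) :
  measurable S ->
  (forall i, P.-integrable S (fun t : borelRV R l => (h t i 0)%:E)) ->
  dot z (mxint P S h) = \int[P]_(t in S) dot z (h t).
Proof.
move=> mS inth; rewrite /dot Rintegral_sum//; last first.
  move=> k; have := @integrableZl _ _ _ P S mS (z k 0) _ (inth k).
  by apply: eq_integrable => // t _; rewrite /= EFinM.
by apply: eq_bigr => k _; rewrite mxE RintegralZl//; exact: inth.
Qed.

Lemma dot_mxint_ge S p (h : 'rV[R]_l -> 'cV[R]_p) (z : 'cV[R]_p) c :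
  measurable S ->
  (forall i, P.-integrable S (fun t : borelRV R l => (h t i 0)%:E)) ->
  {ae P, forall t : borelRV R l, S t -> c <= dot z (h t)} ->
  c * fine (P S) <= dot z (mxint P S h).
Proof.
move=> mS inth ch; rewrite dot_mxint// -Rintegral_cst//.
apply: le_Rintegral_ae => //.
  by apply: bounded_measurable_integrable => //; exact: bounded_measurable_cst.
rewrite (_ : EFin \o _ = (fun t => \sum_k (z k 0 * h t k 0)%:E)%E); last first.
  by apply/funext => t; rewrite /= sumEFin.
apply: integrable_sum => // k _; have := @integrableZl _ _ _ P S mS (z k 0) _ (inth k).
by apply: eq_integrable => // t _; rewrite /= EFinM.
Qed.

Lemma dot_condE_ge S p (h : 'rV[R]_l -> 'cV[R]_p) (z : 'cV[R]_p) c :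
  measurable S -> (0 < P S)%E ->
  (forall i, P.-integrable S (fun t : borelRV R l => (h t i 0)%:E)) ->
  (forall t, S t -> c <= dot z (h t)) ->
  c <= dot z (condE P S h).
Proof.
move=> mS S0 inth ch; rewrite dotZr.
have p0 : 0 < fine (P S).
  by rewrite fine_gt0// S0/= (le_lt_trans (probability_le1 P mS)) ?ltry.
rewrite -(ler_pM2l p0) mulrA mulfV ?gt_eqF// mul1r mulrC.
by apply: dot_mxint_ge => //; exact: aeW.
Qed.

End matrix_integral.

(** * Topology, measurability and support *)

Section continuous_real.
Context (R : realType) (T : topologicalType).
Implicit Types f g : T -> R.

Lemma continuous_funD f g :
  continuous f -> continuous g -> continuous (fun t => f t + g t).
Proof. by move=> cf cg t; exact: cvgD (cf t) (cg t). Qed.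

Lemma continuous_funM f g :
  continuous f -> continuous g -> continuous (fun t => f t * g t).
Proof. by move=> cf cg t; exact: cvgM (cf t) (cg t). Qed.

Lemma continuous_fun_sum (I : finType) (f : I -> T -> R) :
  (forall i, continuous (f i)) -> continuous (fun t => \sum_i f i t).
Proof.
by move=> cf t; apply: cvg_big => [|i _]; [exact: add_continuous | exact: cf].
Qed.

End continuous_real.

Section borel.
Context (R : realType) (l : nat).
Implicit Types D U : set 'rV[R]_l.

Lemma open_borel U : open U -> measurable (U : set (borelRV R l)).
Proof. exact: sub_sigma_algebra. Qed.

Lemma closed_borel U : closed U -> measurable (U : set (borelRV R l)).
Proof. by move=> /closed_openC/open_borel/measurableC; rewrite setCK. Qed.

Lemma compact_borel U : compact U -> measurable (U : set (borelRV R l)).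
Proof. by move=> /(compact_closed (@norm_hausdorff _ _))/closed_borel. Qed.

(** Preimages of open intervals are traces on [D] of open sets. Continuity within [D] is all that
    the recourse offers. *)
Lemma within_continuous_measurable D (f : 'rV[R]_l -> R) :
  measurable (D : set (borelRV R l)) -> {within D, continuous f} ->
  measurable_fun (D : set (borelRV R l)) f.
Proof.
move=> mD cf; have {}cf : continuous (f : subspace D -> R) by [].
apply: (measurability _ (RGenOpens.measurableE R)).
move=> _ [_ [a [b ->] <-]].
have /continuousP/(_ _ (@interval_open _ (BRight a) (BLeft b) isT isT)) := cf.
move=> /open_subspaceP[V oV VD].
by rewrite setIC -VD; apply: measurableI => //; exact: open_borel.
Qed.

Lemma compact_bounded_measurable D (f : 'rV[R]_l -> R) : compact D ->
  {within D, continuous f} -> bounded_measurable (D : set (borelRV R l)) f.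
Proof.
move=> cD cf; split.
  by apply: within_continuous_measurable => //; exact: compact_borel.
have /compact_bounded/ex_strict_bound_gt0[k _ kf] := continuous_compact cf cD.
by exists k => t Dt; apply/ltW/kf; exists t.
Qed.

Lemma continuous_coord m n (H : 'rV[R]_l -> 'M[R]_(m, n)) i j :
  continuous H -> continuous (fun x => H x i j).
Proof.
move=> cH x; apply: (@continuous_comp _ _ _ H (fun Z : 'M[R]_(m, n) => Z i j)).
  exact: cH.
exact: coord_continuous.
Qed.

Lemma continuous_coord_mulmx m n p (H : 'rV[R]_l -> 'M[R]_(m, n))
    (Z : 'M[R]_(n, p)) i j :
  continuous H -> continuous (fun x => (H x *m Z) i j).
Proof.
move=> cH; under eq_fun do rewrite mxE.
apply: continuous_fun_sum => k; apply: continuous_funM; last exact: cst_continuous.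
exact: continuous_coord.
Qed.

Lemma compact_coord_bounded_measurable D m n (H : 'rV[R]_l -> 'M[R]_(m, n)) i j :
  compact D -> continuous H ->
  bounded_measurable (D : set (borelRV R l)) (fun x => H x i j).
Proof.
move=> cD cH; apply: compact_bounded_measurable => //.
by apply: continuous_subspaceT; exact: continuous_coord.
Qed.

Lemma frob_compact_bounded D m n (H : 'rV[R]_l -> 'M[R]_(m, n)) :
  compact D -> continuous H -> exists b, forall x, D x -> frob (H x) <= b.
Proof.
move=> cD cH.
have [_ [b hb]] : bounded_measurable (D : set (borelRV R l)) (fun x => frob (H x)).
  apply: (@bounded_measurable_sum _ (borelRV R l) _ _ _ (fun i x => \sum_j H x i j ^+ 2)) => i.
  apply: (@bounded_measurable_sum _ (borelRV R l) _ _ _ (fun j x => H x i j ^+ 2)) => j.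
  by apply: bounded_measurableM; exact: compact_coord_bounded_measurable.
by exists b => x /hb; apply: le_trans; exact: ler_norm.
Qed.

Lemma compact_unif_continuous (X Y : pseudoMetricType R) (D : set X)
  (f : X -> Y) (e : R) : compact D -> continuous f -> 0 < e ->
  exists2 r, 0 < r & forall x y, D x -> ball x r y -> ball (f x) e (f y).
Proof.
move=> cD cf e0.
pose Q (r : R) x := forall y, ball x r y -> ball (f x) e (f y).
have : \forall r \near 0^'+, D `<=` Q r.
  apply: (iffLR (compact_near_coveringP D) cD) => x Dx.
  have /cvg_ballP/(_ (e / 2)) := cf x; rewrite divr_gt0// => /(_ isT).
  move=> /nbhs_ballP[r /= r0 rf].
  (* Any [z] within r/2 of [x] and any [y] within [d < r / 2] of [z] lie in [ball x r], so both
     images are within e/2 of [f x]. *)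
  exists (ball x (r / 2), [set d | d < r / 2]) => [|[z d] [/= xz dr] y zy].
    split => /=; first by apply: nbhsx_ballx; rewrite divr_gt0.
    by apply: nbhs_right_lt; rewrite divr_gt0.
  have xy : ball x r y.
    by rewrite [r]splitr; apply: ball_triangle xz _; apply: le_ball zy; exact: ltW.
  rewrite [e]splitr; apply: ball_triangle (rf y xy); apply: ball_sym; apply: rf.
  by apply: le_ball xz; rewrite ler_pdivrMr// ler_peMr ?ler1n// ltW.
move=> h; have : \forall r \near (0:R)^'+, 0 < r /\ D `<=` Q r.
  by near=> r; split; [near: r; exact: nbhs_right_gt | near: r].
by move=> /filter_ex[r [r0 rD]]; exists r => // x y Dx; exact: rD.
Unshelve. all: by end_near. Qed.

(** [ball] refers to the sup norm, [diam] to the larger Euclidean norm. Compactness bounds the set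
    of distances, without which [sup] says nothing. *)
Lemma diam_ball D x y r : compact D -> D x -> D y -> diam D < r -> ball x r y.
Proof.
move=> cD Dx Dy Dr.
have xyD : enormr (x - y) <= diam D.
  apply: ub_le_sup; last by exists x => //; exists y.
  have /compact_bounded/ex_strict_bound_gt0[k k0 kD] := cD.
  exists (Num.sqrt (\sum_(i < l) (k + k) ^+ 2)) => _ [a Da [c Dc <-]].
  rewrite ler_wsqrtr//; apply: ler_sum => i _.
  rewrite -real_normK ?num_real// lerXn2r ?nnegrE ?addr_ge0 ?(ltW k0)//.
  have e u : D u -> `|u 0 i| < k.
    move=> /kD; apply: le_lt_trans.
    rewrite [leRHS]/Num.norm/= mx_normrE.
    by apply/bigmax_geP; right; exists (0, i).
  by rewrite !mxE (le_trans (ler_normB _ _))// lerD// ltW// e.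
have r0 : 0 < r by rewrite (le_lt_trans _ Dr)// (le_trans _ xyD)// sqrtr_ge0.
split => // i j; rewrite ord1 /ball/= /ball_/= (le_lt_trans _ Dr)//.
apply: le_trans xyD; rewrite -sqrtr_sqr ler_wsqrtr//.
rewrite (bigD1 j)//= !mxE lerDl; apply: sumr_ge0 => k _; exact: sqr_ge0.
Qed.

Section support.
Variable P : probability (borelRV R l) R.

(** A Lindelof argument: every point off the support lies in a null ball with rational centre and
    radius 1/(n+1). [F] enumerates these balls and is empty at the remaining codes, so that each of
    its terms is negligible. *)
Lemma supp_full : P.-negligible (~` supp P).
Proof.
pose F (k : nat) : set 'rV[R]_l :=
  if @unpickle ('rV[rat]_l * nat)%type k is Some (q, n) then
    let U := ball (map_mx ratr q : 'rV[R]_l) n.+1%:R^-1 in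
    if P U == 0%E then U else set0
  else set0.
suff sF : ~` supp P `<=` \bigcup_k F k.
  apply: (negligibleS (A := \bigcup_k (F k : set (borelRV R l)))) => //.
  apply: negligible_bigcup => k; rewrite /F.
  case: unpickle => [[q n]|]; last exact: negligible_set0.
  case: ifPn => [/eqP P0|_]; last exact: negligible_set0.
  by exists (ball (map_mx ratr q : 'rV[R]_l) n.+1%:R^-1); split => //;
    apply: open_borel; exact: ball_open.
move=> x; rewrite /supp /= => /existsNP[e /not_implyP[e0 /negP Pe]].
have {}Pe : P (ball x e) = 0%E.
  by apply/eqP; rewrite eq_le measure_ge0 andbT leNgt.
have [n ne] : exists n, n.+1%:R^-1 < e / 2.
  have e20 : 0 < e / 2 by rewrite divr_gt0.
  exists (Num.truncn (e / 2)^-1); rewrite -[ltRHS]invrK ltf_pV2 ?posrE ?invr_gt0//.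
  exact: truncnS_gt.
have n0 : 0 < (n.+1%:R^-1 : R) by rewrite invr_gt0.
have qx i : exists q : rat, ratr q \in `]x 0 i, (x 0 i + n.+1%:R^-1)[.
  by have [|q hq] := @rat_in_itvoo R (x 0 i) (x 0 i + n.+1%:R^-1);
    [rewrite ltrDl | exists q].
pose q : 'rV[rat]_l := \row_i xchoose (qx i).
have qxb : ball (map_mx ratr q : 'rV[R]_l) n.+1%:R^-1 x.
  split => // i j; rewrite ord1 !mxE /ball/= /ball_/=.
  have := xchooseP (qx j); rewrite in_itv/= => /andP[a b].
  by rewrite ger0_norm ?subr_ge0 ?ltW// ltrBlDl.
exists (pickle (q, n)) => //; rewrite /F pickleK.
case: ifPn => // /eqP; case; apply: subset_measure0 Pe.
- by apply: open_borel; exact: ball_open.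
- by apply: open_borel; exact: ball_open.
move=> y qy; rewrite [e]splitr; apply: ball_triangle.
  by apply: ball_sym; apply: le_ball qxb; exact: ltW.
by apply: le_ball qy; exact: ltW.
Qed.

(** A negative value at a point of the support would persist on a ball, which has positive mass yet
    lies in the exceptional null set. *)
Lemma supp_ae_ge0 (g : 'rV[R]_l -> R) : continuous g ->
  {ae P, forall x : borelRV R l, 0 <= g x} -> forall x, supp P x -> 0 <= g x.
Proof.
move=> cg [N [mN N0 gN]] x Px; rewrite leNgt; apply/negP => gx.
have /nbhs_ballP[e /= e0 eg] : \forall y \near x, g y < 0.
  by have /cvgr_lt := cg x; exact.
have := Px e e0; apply/negP; rewrite -leNgt -N0; apply: le_measure; rewrite ?inE//.
  by apply: open_borel; exact: ball_open.
by move=> y /eg gy; apply: gN => /=; apply/negP; rewrite -ltNge.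
Qed.

End support.
End borel.

Section bounded_measurable_matrix.
Context (R : realType) (l : nat) (P : probability (borelRV R l) R).
Implicit Types S : set (borelRV R l).

Lemma bounded_measurable_indic S (f : borelRV R l -> R) : measurable S ->
  bounded_measurable S f -> bounded_measurable setT (fun t => \1_S t * f t).
Proof.
move=> mS [mf [c fc]]; split.
  rewrite (_ : (fun t => _) = f \_ S); last first.
    apply/funext => t; rewrite patchE indicE; case: ifPn => _.
      by rewrite mul1r.
    by rewrite mul0r.
  by apply/(measurable_restrict _ mS measurableT); rewrite setTI.
exists `|c| => t _; rewrite indicE; have [St|St] := boolP (t \in S).
  by rewrite mul1r (le_trans (fc t _)) ?ler_norm//; exact/set_mem.
by rewrite mul0r normr0.
Qed.

Definition bounded_measurable_mx S p q (H : 'rV[R]_l -> 'M[R]_(p, q)) :=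
  forall i j, bounded_measurable S (fun t : borelRV R l => H t i j).

Lemma bounded_measurable_mx_cst S p q (c : 'M[R]_(p, q)) :
  bounded_measurable_mx S (fun=> c).
Proof. by move=> i j; exact: bounded_measurable_cst. Qed.

Lemma bounded_measurable_mxM S p q r (H : 'rV[R]_l -> 'M[R]_(p, q))
    (K : 'rV[R]_l -> 'M[R]_(q, r)) :
  bounded_measurable_mx S H -> bounded_measurable_mx S K ->
  bounded_measurable_mx S (fun t => H t *m K t).
Proof.
move=> bH bK i j; under eq_fun do rewrite mxE.
apply: (@bounded_measurable_sum _ (borelRV R l)) => k.
exact: bounded_measurableM.
Qed.

Lemma bounded_measurable_mxD S p q (H K : 'rV[R]_l -> 'M[R]_(p, q)) :
  bounded_measurable_mx S H -> bounded_measurable_mx S K ->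
  bounded_measurable_mx S (fun t => H t + K t).
Proof.
by move=> bH bK i j; under eq_fun do rewrite mxE; exact: bounded_measurableD.
Qed.

Lemma bounded_measurable_mxZ S p q c (H : 'rV[R]_l -> 'M[R]_(p, q)) :
  bounded_measurable S c -> bounded_measurable_mx S H ->
  bounded_measurable_mx S (fun t => c t *: H t).
Proof.
by move=> bc bH i j; under eq_fun do rewrite mxE; exact: bounded_measurableM.
Qed.

Lemma bounded_measurable_mxB S p q (H K : 'rV[R]_l -> 'M[R]_(p, q)) :
  bounded_measurable_mx S H -> bounded_measurable_mx S K ->
  bounded_measurable_mx S (fun t => H t - K t).
Proof.
move=> bH bK; under [X in bounded_measurable_mx _ X]eq_fun do rewrite -scaleN1r.
apply: bounded_measurable_mxD => //; apply: bounded_measurable_mxZ => //.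
exact: bounded_measurable_cst.
Qed.

Lemma bounded_measurable_mx_sum S p q (I : finType)
    (H : I -> 'rV[R]_l -> 'M[R]_(p, q)) :
  (forall i, bounded_measurable_mx S (H i)) ->
  bounded_measurable_mx S (fun t => \sum_i H i t).
Proof.
move=> bH i j; under eq_fun do rewrite summxE.
by apply: (@bounded_measurable_sum _ (borelRV R l)) => k; exact: bH.
Qed.

Lemma bounded_measurable_dot S p (H K : 'rV[R]_l -> 'cV[R]_p) :
  bounded_measurable_mx S H -> bounded_measurable_mx S K ->
  bounded_measurable S (fun t : borelRV R l => dot (H t) (K t)).
Proof.
move=> bH bK; apply: (@bounded_measurable_sum _ (borelRV R l)) => k.
exact: bounded_measurableM.
Qed.

Lemma bounded_measurable_mx_int S p q (H : 'rV[R]_l -> 'M[R]_(p, q)) :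
  measurable S -> bounded_measurable_mx S H ->
  forall i j, P.-integrable S (fun t : borelRV R l => (H t i j)%:E).
Proof.
by move=> mS bH i j; apply: (bounded_measurable_integrable P mS (bH i j)).
Qed.

End bounded_measurable_matrix.

(** * The two-stage SLCP *)

Section slcp.
Context (R : realType) (n m l : nat) (P : probability (borelRV R l) R).
Variables (Xi : set 'rV[R]_l) (A : 'M[R]_n) (q1 : 'cV[R]_n).
Variables (B : 'rV[R]_l -> 'M[R]_(n, m)) (M : 'rV[R]_l -> 'M[R]_m).
Variables (N : 'rV[R]_l -> 'M[R]_(m, n)) (q2 : 'rV[R]_l -> 'cV[R]_m) (k : R).
Hypothesis PXi : P.-negligible (~` Xi).
Hypothesis cXi : compact Xi.
Hypotheses (cB : continuous B) (cM : continuous M).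
Hypotheses (cN : continuous N) (cq2 : continuous q2).
Hypothesis k0 : 0 < k.
Hypothesis coer : forall t, Xi t -> forall z u,
  k * (sqnorm z + sqnorm u) <=
  dot z (A *m z + B t *m u) + dot u (N t *m z + M t *m u).

Let mXi : measurable (Xi : set (borelRV R l)) := compact_borel cXi.

Lemma continuous_bounded_mx p q (H : 'rV[R]_l -> 'M[R]_(p, q)) :
  continuous H -> bounded_measurable_mx Xi H.
Proof. by move=> cH i j; exact: compact_coord_bounded_measurable. Qed.

(** Apply [lcp_stab] at [s] against [t]. The defect is [h s - h t], where the solution is frozen at
    its value [y] for [t], so [h] depends on [s] only through the continuous data. *)
Lemma recourse_continuous x i :
  {within Xi, continuous (fun t => recourse M N q2 x t i 0)}.
Proof.
apply/subspace_continuousP => t Xt.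
set y := recourse M N q2 x t.
pose h s := M s *m y + N s *m x + q2 s.
have ch j : continuous (fun s => h s j 0).
  under eq_fun do rewrite mxE [X in X + _]mxE.
  apply: continuous_funD; last exact: continuous_coord.
  by apply: continuous_funD; exact: continuous_coord_mulmx.
have hs s : Xi s ->
    k ^+ 2 * sqnorm (recourse M N q2 x s - y) <= sqnorm (h s - h t).
  move=> Xs.
  have := lcp_stab k0 (coercive_diag coer Xs)
    (lcp_mapP k0 (N s *m x + q2 s) (coercive_diag coer Xs))
    (lcp_mapP k0 (N t *m x + q2 t) (coercive_diag coer Xt)).
  rewrite -/(recourse M N q2 x s) -/(recourse M N q2 x t) -/y.
  rewrite (_ : _ + _ = h s - h t)//.
  by rewrite /h mulmxBl addrACA -opprD !addrA.
have c0 : sqnorm (h s - h t) @[s --> t] --> (0 : R).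
  have -> : 0 = sqnorm (h t - h t) :> R by rewrite subrr sqnorm0.
  have : continuous (fun s => \sum_j (h s j 0 - h t j 0) ^+ 2).
    by apply: continuous_fun_sum => j; apply: continuous_funM;
      (apply: continuous_funD; [exact: ch | exact: cst_continuous]).
  have -> : (fun s => \sum_j (h s j 0 - h t j 0) ^+ 2) = (fun s => sqnorm (h s - h t)).
    by apply/funext => s; apply: eq_bigr => j _; rewrite !mxE.
  exact.
apply/cvgrPdist_le => e e0.
have ke : 0 < k ^+ 2 * e ^+ 2 by rewrite mulr_gt0 ?exprn_gt0.
move/cvgrPdist_le : c0 => /(_ _ ke) c0.
apply: filterS c0 => s; rewrite sub0r normrN ger0_norm ?sqnorm_ge0// => c0 Xs.
have := le_trans (hs s Xs) c0; rewrite ler_pM2l ?exprn_gt0// => se.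
rewrite distrC -(@ler_pXn2r _ 2) ?nnegrE ?(ltW e0) ?normr_ge0//.
rewrite real_normK ?num_real//.
apply: le_trans se; apply: le_trans (sqnorm_entry _ i).
by rewrite !mxE.
Qed.

Lemma recourse_bounded_mx x : bounded_measurable_mx Xi (recourse M N q2 x).
Proof.
move=> i j; rewrite ord1; apply: compact_bounded_measurable => //.
exact: recourse_continuous.
Qed.

(** Off [Xi] the recourse is an uncontrolled choice; cutting it off there makes it Borel on the
    whole space, as [slcp_sol] demands. *)
Definition recourseXi x t : 'cV[R]_m := \1_Xi t *: recourse M N q2 x t.

Lemma recourseXiE x t : Xi t -> recourseXi x t = recourse M N q2 x t.
Proof. by move=> Xt; rewrite /recourseXi indicE mem_set// scale1r. Qed.

Lemma recourseXi_bounded x : bounded_measurable_mx setT (recourseXi x).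
Proof.
move=> i j; under eq_fun do rewrite mxE.
by apply: bounded_measurable_indic => //; exact: recourse_bounded_mx.
Qed.

Lemma mul_recourseXi_bounded x :
  bounded_measurable_mx setT (fun t => B t *m recourseXi x t).
Proof.
move=> i j; under eq_fun do rewrite -scalemxAr mxE.
apply: bounded_measurable_indic => //.
apply: bounded_measurable_mxM; last exact: recourse_bounded_mx.
exact: continuous_bounded_mx.
Qed.

Let G x : 'cV[R]_n := mxint P setT (fun t => B t *m recourseXi x t).

Lemma ae_Xi : {ae P, forall t : borelRV R l, Xi t}.
Proof. exact: PXi. Qed.

Lemma expected_recourse_averages : averages Xi B M N q2 G.
Proof.
move=> x x' z c hc.
have int_w x0 := bounded_measurable_mx_int P measurableT (mul_recourseXi_bounded x0).
have -> : G x - G x' =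
    mxint P setT (fun t => B t *m (recourseXi x t - recourseXi x' t)).
  apply/matrixP => i j; rewrite !mxE -RintegralB//; [|exact: int_w|exact: int_w].
  by congr fine; apply: eq_integral => t _; rewrite mulmxBr !mxE.
rewrite -[c]mulr1 -[X in c * X]/(fine 1) -(@probability_setT _ _ _ P).
apply: dot_mxint_ge => //.
  move=> i; apply: bounded_measurable_mx_int => //.
  under [X in bounded_measurable_mx _ X]eq_fun do rewrite mulmxBr.
  by apply: bounded_measurable_mxB; exact: mul_recourseXi_bounded.
by apply: ae_imply ae_Xi => t Xt _; rewrite !recourseXiE//; exact: hc.
Qed.

Lemma compact_frob_bound : exists2 b, 0 <= b &
  (forall t, Xi t -> frob (B t) <= b) /\ (forall t, Xi t -> frob (N t) <= b).
Proof.
have [b Bb] := frob_compact_bounded cXi cB.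
have [c Nc] := frob_compact_bounded cXi cN.
exists (Num.max 0 (Num.max b c)); first by rewrite le_max lexx.
by split => t Xt; rewrite !le_max ?Bb ?Nc ?orbT.
Qed.

(** Any solution agrees almost everywhere with the recourse of its first stage, which therefore
    solves the reduced problem; that problem has exactly one solution. *)
Lemma slcp_exists_unique : exists2 xs, slcp_sol P A q1 B M N q2 xs (recourseXi xs) &
  forall x' y', slcp_sol P A q1 B M N q2 x' y' ->
    x' = xs /\ {ae P, forall t : borelRV R l, y' t = recourseXi xs t}.
Proof.
have [b b0 [Bb Nb]] := compact_frob_bound.
have [xs hxs] := two_stage_exists q1 k0 b0 Bb Nb coer expected_recourse_averages.
exists xs.
  split; [by move=> a; have [] := recourseXi_bounded xs a 0|split].
    move=> a; apply: bounded_measurable_mx_int => //.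
    exact: mul_recourseXi_bounded.
  split => //; apply: ae_imply ae_Xi => t Xt.
  by rewrite recourseXiE//; exact: recourseP k0 coer _ _ _.
move=> x' y' [my [inty [cx cy]]].
have y'E : {ae P, forall t : borelRV R l, y' t = recourseXi x' t}.
  apply: ae_imply2 ae_Xi cy => t Xt ct.
  by rewrite recourseXiE//; exact: recourse_unique k0 coer _ _ _ Xt ct.
have e : x' = xs.
  apply: (two_stage_unique k0 coer expected_recourse_averages _ hxs).
  rewrite (_ : G x' = mxint P setT (fun t => B t *m y' t))//.
  apply/matrixP => i j; rewrite !mxE; apply: eq_Rintegral_ae => //.
  - by apply: bounded_measurable_mx_int => //; exact: mul_recourseXi_bounded.
  - by rewrite ord1; exact: inty.
  - by apply: ae_imply y'E => t -> _.
by split => //; rewrite -e.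
Qed.

End slcp.

(** * Discretization *)

Section conditional_expectation.
Context (R : realType) (l : nat) (P : probability (borelRV R l) R).
Variable S : set (borelRV R l).
Hypotheses (mS : measurable S) (S0 : (0 < P S)%E).

Let p0 : 0 < fine (P S).
Proof. by rewrite fine_gt0// S0/= (le_lt_trans (probability_le1 P mS)) ?ltry. Qed.

Lemma condE_mulmx p q (H : 'rV[R]_l -> 'M[R]_(p, q)) (u : 'cV[R]_q) :
  bounded_measurable_mx S H ->
  condE P S H *m u = condE P S (fun t => H t *m u).
Proof.
move=> bH; rewrite /condE -scalemxAl mxint_mulmx//.
exact: bounded_measurable_mx_int.
Qed.

Lemma condED p q (H K : 'rV[R]_l -> 'M[R]_(p, q)) :
  bounded_measurable_mx S H -> bounded_measurable_mx S K ->
  condE P S (fun t => H t + K t) = condE P S H + condE P S K.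
Proof.
move=> bH bK; rewrite -scalerDr; congr (_ *: _); apply/matrixP => i j.
rewrite !mxE -RintegralD//; [|exact: bounded_measurable_mx_int..].
by congr fine; apply: eq_integral => t _; rewrite mxE.
Qed.

Lemma condE_cst p q (c : 'M[R]_(p, q)) : condE P S (fun=> c) = c.
Proof.
apply/matrixP => i j; rewrite !mxE.
rewrite -/(Rintegral P S (fun=> c i j)) Rintegral_cst//.
by rewrite mulrCA mulVf ?mulr1// gt_eqF.
Qed.

Lemma dot_condE p (z : 'cV[R]_p) (h : 'rV[R]_l -> 'cV[R]_p) :
  bounded_measurable_mx S h ->
  dot z (condE P S h) = (fine (P S))^-1 * \int[P]_(t in S) dot z (h t).
Proof.
move=> bh; rewrite dotZr dot_mxint// => i.
exact: bounded_measurable_mx_int.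
Qed.

(** Jensen's inequality for the squared norm, obtained by testing the mean [w] against [- w] as in
    the Lipschitz bound for [G]. *)
Lemma sqnorm_condE_le p (h : 'rV[R]_l -> 'cV[R]_p) c :
  bounded_measurable_mx S h -> (forall t, S t -> sqnorm (h t) <= c) ->
  sqnorm (condE P S h) <= c.
Proof.
move=> bh hc; set w := condE P S h.
suff : - (2^-1 * (sqnorm w + c)) <= dot (- w) w by rewrite dotNl -sqnormE; lra.
apply: dot_condE_ge => //.
  by move=> i; exact: bounded_measurable_mx_int.
move=> t St; have := young w (h t) ltr01; have := hc t St.
by rewrite dotNl mulr1; lra.
Qed.

End conditional_expectation.

Section discretization.
Context (R : realType) (n m l : nat) (P : probability (borelRV R l) R).
Variables (Xi : set 'rV[R]_l) (A : 'M[R]_n) (q1 : 'cV[R]_n).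
Variables (B : 'rV[R]_l -> 'M[R]_(n, m)) (M : 'rV[R]_l -> 'M[R]_m).
Variables (N : 'rV[R]_l -> 'M[R]_(m, n)) (q2 : 'rV[R]_l -> 'cV[R]_m) (k : R).
Hypothesis PXi : P.-negligible (~` Xi).
Hypothesis cXi : compact Xi.
Hypotheses (cB : continuous B) (cM : continuous M).
Hypotheses (cN : continuous N) (cq2 : continuous q2).
Hypothesis k0 : 0 < k.
Hypothesis coer : forall t, Xi t -> forall z u,
  k * (sqnorm z + sqnorm u) <=
  dot z (A *m z + B t *m u) + dot u (N t *m z + M t *m u).

Variables (K : nat) (Xs : 'I_K -> set 'rV[R]_l).
Hypothesis cXs : forall i, compact (Xs i).
Hypothesis Xs0 : forall i j, i != j -> P (Xs i `&` Xs j) = 0%E.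
Hypothesis XsU : \bigcup_(i in [set: 'I_K]) Xs i = Xi.
Hypothesis PXs : forall i, (0 < P (Xs i))%E.

Let mXs i : measurable (Xs i : set (borelRV R l)) := compact_borel (@cXs i).

Let XsXi i : Xs i `<=` Xi.
Proof. by move=> t Xt; rewrite -XsU; exists i. Qed.

Let p i := fine (P (Xs i)).

Let p0 i : 0 < p i.
Proof. by rewrite fine_gt0// PXs/= (le_lt_trans (probability_le1 P (mXs i))) ?ltry. Qed.

(** Finitely many pairwise overlaps, all null, are discarded together with the complement of
    [Xi]. *)
Lemma ae_unique_cell :
  {ae P, forall t : borelRV R l, exists2 i, Xs i t & forall j, Xs j t -> j = i}.
Proof.
have disj : {ae P, forall t : borelRV R l, forall i j, i != j -> ~ (Xs i `&` Xs j) t}.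
  apply: ae_forall => i; apply: ae_forall => j.
  have [ij|ij] := eqVneq i j; first exact: aeW.
  exists (Xs i `&` Xs j); split; [exact: measurableI | exact: Xs0|].
  by move=> t /= /not_implyP[_ /contrapT].
apply: ae_imply2 (ae_Xi PXi) disj => t; rewrite -{1}XsU => -[i _ it] dt.
exists i => // j jt; apply/eqP; apply: contrapT => /negP ji.
exact: dt ji (conj jt it).
Qed.

(** On an overlap of cells the values add up; by [ae_unique_cell] this concerns a null set only. *)
Definition step_fun q (v : 'I_K -> 'cV[R]_q) (t : 'rV[R]_l) : 'cV[R]_q :=
  \sum_(i < K) \1_(Xs i) t *: v i.

Lemma step_fun_cell q (v : 'I_K -> 'cV[R]_q) t i :
  Xs i t -> (forall j, Xs j t -> j = i) -> step_fun v t = v i.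
Proof.
move=> it ui; rewrite /step_fun (bigD1 i)//= big1 ?addr0.
  by rewrite indicE mem_set// scale1r.
move=> j ji; rewrite indicE memNset ?scale0r// => /ui e.
by rewrite e eqxx in ji.
Qed.

Let indic_bounded i : bounded_measurable setT (\1_(Xs i) : borelRV R l -> R).
Proof.
split; first exact: measurable_indic.
by exists 1 => t _; rewrite indicE; case: (_ \in _); rewrite ?normr1 ?normr0.
Qed.

Lemma step_fun_bounded q (v : 'I_K -> 'cV[R]_q) :
  bounded_measurable_mx setT (step_fun v).
Proof.
apply: bounded_measurable_mx_sum => i; apply: bounded_measurable_mxZ => //.
exact: bounded_measurable_mx_cst.
Qed.

Let Xs_bounded q r (H : 'rV[R]_l -> 'M[R]_(q, r)) i :
  continuous H -> bounded_measurable_mx (Xs i) H.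
Proof. by move=> cH; exact: continuous_bounded_mx. Qed.

Lemma sum_cell_probability : \sum_i p i = 1.
Proof.
have -> : 1 = \int[P]_t (cst 1 t) :> R.
  by rewrite Rintegral_cst// mul1r; exact: esym (congr1 fine (@probability_setT _ _ _ P)).
have <- : \int[P]_t (\sum_i \1_(Xs i) t) = \sum_i p i.
  rewrite Rintegral_sum//.
    by apply: eq_bigr => i _; rewrite /Rintegral integral_indic// setIT.
  by move=> i; exact: bounded_measurable_integrable.
apply: eq_Rintegral_ae => //.
- apply: bounded_measurable_integrable => //.
  exact: (@bounded_measurable_sum _ (borelRV R l)).
- by apply: bounded_measurable_integrable => //; exact: bounded_measurable_cst.
apply: ae_imply ae_unique_cell => t [i it ui] _.
rewrite (bigD1 i)//= big1 ?addr0; first by rewrite indicE mem_set.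
move=> j ji; rewrite indicE memNset// => /ui e.
by rewrite e eqxx in ji.
Qed.

Let mul_step_fun (v : 'I_K -> 'cV[R]_m) t :
  B t *m step_fun v t = \sum_i \1_(Xs i) t *: (B t *m v i).
Proof. by rewrite mulmx_sumr; apply: eq_bigr => i _; rewrite scalemxAr. Qed.

Let indic_mul_bounded (v : 'I_K -> 'cV[R]_m) i :
  bounded_measurable_mx setT (fun t => \1_(Xs i) t *: (B t *m v i)).
Proof.
move=> a b; under eq_fun do rewrite mxE.
apply: bounded_measurable_indic => //.
apply: bounded_measurable_mxM; first exact: Xs_bounded.
exact: bounded_measurable_mx_cst.
Qed.

Lemma mul_step_fun_bounded (v : 'I_K -> 'cV[R]_m) :
  bounded_measurable_mx setT (fun t => B t *m step_fun v t).
Proof.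
under [X in bounded_measurable_mx _ X]eq_fun do rewrite mul_step_fun.
exact: bounded_measurable_mx_sum.
Qed.

(* No discretization error here: [B] is integrated exactly on each cell. *)
Lemma mxint_mul_step_fun (v : 'I_K -> 'cV[R]_m) :
  mxint P setT (fun t => B t *m step_fun v t) =
  \sum_i p i *: (condE P (Xs i) B *m v i).
Proof.
apply/matrixP => a b; rewrite summxE mxE.
rewrite -/(Rintegral P setT (fun t => (B t *m step_fun v t) a b)).
under eq_Rintegral do rewrite mul_step_fun summxE.
rewrite Rintegral_sum//; last first.
  by move=> i; apply: bounded_measurable_mx_int => //; exact: indic_mul_bounded.
apply: eq_bigr => i _; rewrite condE_mulmx//; last exact: Xs_bounded.
rewrite scalerA mulfV ?scale1r ?gt_eqF// mxE.
rewrite -/(Rintegral P (Xs i) (fun t => (B t *m v i) a b)) [RHS]Rintegral_mkcond.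
congr fine; apply: eq_integral => t _; rewrite patchE mxE indicE.
by case: ifPn => _; rewrite ?mul1r ?mul0r.
Qed.

Let Bd i := condE P (Xs i) B.
Let Md i := condE P (Xs i) M.
Let Nd i := condE P (Xs i) N.
Let qd i := condE P (Xs i) q2.

Lemma condE_coercive i z u :
  k * (sqnorm z + sqnorm u) <=
  dot z (A *m z + Bd i *m u) + dot u (Nd i *m z + Md i *m u).
Proof.
have bB : bounded_measurable_mx (Xs i) (fun t => B t *m u).
  apply: bounded_measurable_mxM; first exact: Xs_bounded.
  exact: bounded_measurable_mx_cst.
have bN : bounded_measurable_mx (Xs i) (fun t => N t *m z).
  apply: bounded_measurable_mxM; first exact: Xs_bounded.
  exact: bounded_measurable_mx_cst.
have bM : bounded_measurable_mx (Xs i) (fun t => M t *m u).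
  apply: bounded_measurable_mxM; first exact: Xs_bounded.
  exact: bounded_measurable_mx_cst.
rewrite /Bd /Nd /Md !condE_mulmx//; [|exact: Xs_bounded..].
rewrite -condED// dotDr !dot_condE//; last exact: bounded_measurable_mxD.
have bd1 : bounded_measurable (Xs i : set (borelRV R l)) (fun t : borelRV R l => dot z (B t *m u)).
  by apply: bounded_measurable_dot => //; exact: bounded_measurable_mx_cst.
have bd2 : bounded_measurable (Xs i : set (borelRV R l))
    (fun t : borelRV R l => dot u (N t *m z + M t *m u)).
  apply: bounded_measurable_dot; first exact: bounded_measurable_mx_cst.
  exact: bounded_measurable_mxD.
rewrite -addrA -mulrDr -RintegralD//; [|exact: bounded_measurable_integrable..].
rewrite -lerBlDl -(ler_pM2l (p0 i)) mulrA mulfV ?mul1r ?gt_eqF//.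
rewrite mulrC -Rintegral_cst//; apply: le_Rintegral_ae => //.
- by apply: bounded_measurable_integrable => //; exact: bounded_measurable_cst.
- apply: bounded_measurable_integrable => //; exact: bounded_measurableD.
apply: aeW => t it; have := coer (XsXi it) z u.
by rewrite !dotDr; lra.
Qed.

Let coerd i : [set: 'I_K] i -> forall z u,
  k * (sqnorm z + sqnorm u) <=
  dot z (A *m z + Bd i *m u) + dot u (Nd i *m z + Md i *m u).
Proof. by move=> _; exact: condE_coercive. Qed.

Let Gd x : 'cV[R]_n := \sum_i p i *: (Bd i *m recourse Md Nd qd x i).

Lemma discrete_recourse_averages : averages setT Bd Md Nd qd Gd.
Proof.
move=> x x' z c hc; rewrite /Gd -sumrB dot_sumr -[c]mul1r -sum_cell_probability.
rewrite mulr_suml; apply: ler_sum => i _.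
by rewrite -scalerBr -mulmxBr dotZr ler_pM2l// hc.
Qed.

Lemma disc_exists_unique : exists (x : 'cV[R]_n) (ys : 'I_K -> 'cV[R]_m),
  disc_sol P A q1 B M N q2 Xs x ys /\
  forall x' ys', disc_sol P A q1 B M N q2 Xs x' ys' ->
    x' = x /\ forall i, ys' i = ys i.
Proof.
(* This crude bound depends on the partition, which is harmless: it serves only to produce a
   contraction. *)
pose b := \sum_i frob (Bd i) + \sum_i frob (Nd i).
have frob_sum0 q r (H : 'I_K -> 'M[R]_(q, r)) : 0 <= \sum_i frob (H i).
  by apply: sumr_ge0 => i _; exact: frob_ge0.
have frob_le q r (H : 'I_K -> 'M[R]_(q, r)) i : frob (H i) <= \sum_i frob (H i).
  by rewrite (bigD1 i)//= lerDl sumr_ge0// => j _; exact: frob_ge0.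
have b0 : 0 <= b by rewrite addr_ge0.
have Bb i : [set: 'I_K] i -> frob (Bd i) <= b.
  by move=> _; rewrite (le_trans (frob_le _ _ Bd i))// lerDl.
have Nb i : [set: 'I_K] i -> frob (Nd i) <= b.
  by move=> _; rewrite (le_trans (frob_le _ _ Nd i))// lerDr.
have [x hx] := two_stage_exists q1 k0 b0 Bb Nb coerd discrete_recourse_averages.
exists x, (recourse Md Nd qd x); split.
  by split => // i; exact: recourseP k0 coerd _ _ I.
move=> x' ys' [hx' hys'].
have ysE i : ys' i = recourse Md Nd qd x' i.
  exact: recourse_unique k0 coerd _ _ _ I (hys' i).
have e : x' = x.
  apply: (two_stage_unique k0 coerd discrete_recourse_averages _ hx).
  rewrite (_ : Gd x' = \sum_i p i *: (Bd i *m ys' i))//.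
  by apply: eq_bigr => i _; rewrite ysE.
by split => // i; rewrite ysE e.
Qed.

Let bounded_affine i x y :
  bounded_measurable_mx (Xs i) (fun t => M t *m y + N t *m x + q2 t).
Proof.
apply: bounded_measurable_mxD; last exact: Xs_bounded.
by apply: bounded_measurable_mxD;
  (apply: bounded_measurable_mxM; [exact: Xs_bounded | exact: bounded_measurable_mx_cst]).
Qed.

(** With [x] and [y] fixed over the cell, the discretized second-stage map is a single mean, to
    which [sqnorm_condE_le] applies. *)
Let condE_affine i x y : Md i *m y + Nd i *m x + qd i =
  condE P (Xs i) (fun t => M t *m y + N t *m x + q2 t).
Proof.
rewrite condED//; last exact: Xs_bounded; last first.
  by apply: bounded_measurable_mxD;
  (apply: bounded_measurable_mxM; [exact: Xs_bounded | exact: bounded_measurable_mx_cst]).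
rewrite condED//; last 2 first.
- by apply: bounded_measurable_mxM; [exact: Xs_bounded | exact: bounded_measurable_mx_cst].
- by apply: bounded_measurable_mxM; [exact: Xs_bounded | exact: bounded_measurable_mx_cst].
by rewrite -!condE_mulmx//; exact: Xs_bounded.
Qed.

(** [b] and [c] are bounds over all of [Xi], so these estimates are uniform in the partition. *)
Lemma disc_bound (b c : R) x ys :
  (forall t, Xi t -> frob (N t) <= b) ->
  (forall t, Xi t -> sqnorm (q2 t) <= c) ->
  disc_sol P A q1 B M N q2 Xs x ys ->
  k ^+ 2 * sqnorm x <= c + sqnorm q1 /\
  forall i, k ^+ 2 * sqnorm (ys i) <= 2 * (b * sqnorm x + c).
Proof.
move=> Nb q2c [cx cy]; split.
  apply: (two_stage_bound k0 coerd _ (fun i _ => cy i) _ cx).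
    move=> i _; apply: sqnorm_condE_le => //; first exact: Xs_bounded.
    by move=> t it; apply/q2c/(XsXi it).
  move=> z d hd; rewrite dot_sumr -[d]mul1r -sum_cell_probability.
  by rewrite mulr_suml; apply: ler_sum => i _; rewrite dotZr ler_pM2l// hd.
move=> i; have := cy i; rewrite -addrA => cyi.
apply: le_trans (lcp_bound k0 (coercive_diag coerd I) cyi) _.
have -> : condE P (Xs i) N *m x + condE P (Xs i) q2 =
    condE P (Xs i) (fun t => M t *m 0 + N t *m x + q2 t).
  by rewrite -condE_affine mulmx0 add0r.
apply: sqnorm_condE_le => // t it; rewrite mulmx0 add0r.
apply: le_trans (sqnormD_le _ _) _; rewrite ler_pM2l// lerD ?q2c//; try exact: XsXi it.
apply: le_trans (sqnorm_mulmx_le _ _) _.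
by rewrite ler_wpM2r ?sqnorm_ge0// Nb//; exact: XsXi it.
Qed.

(** * Quantitative comparison of the discretized and the true solution *)

Section estimate.
Variables (x xs : 'cV[R]_n) (ys : 'I_K -> 'cV[R]_m) (Cx Cy eta : R).
Hypothesis dsol : disc_sol P A q1 B M N q2 Xs x ys.
Hypothesis csol : slcp_sol P A q1 B M N q2 xs (recourseXi Xi M N q2 xs).
Hypothesis xC : sqnorm x <= Cx.
Hypothesis yC : forall i, sqnorm (ys i) <= Cy.
Hypothesis eta0 : 0 <= eta.
Hypothesis osc : forall i s t, Xs i s -> Xs i t ->
  [/\ frob (M s - M t) <= eta, frob (N s - N t) <= eta &
      sqnorm (q2 s - q2 t) <= eta].

(** Two uses of [sqnormD_le] give 4(Cx + Cy) + 2 times [eta], rounded up. *)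
Let err := 4 * (Cx + Cy + 1) * eta.
Let y := recourseXi Xi M N q2 xs.
Let du t := step_fun ys t - y t.

(** The residual is the mean over [s] in the cell of the change in the data between [t] and [s],
    applied to the bounded vectors [x] and [ys i]. *)
Let residual_le i t : Xs i t -> sqnorm (Md i *m ys i + Nd i *m x + qd i -
  (M t *m ys i + N t *m x + q2 t)) <= err.
Proof.
move=> it; set c := M t *m ys i + _ + _.
have -> : Md i *m ys i + Nd i *m x + qd i - c =
    condE P (Xs i) (fun s => M s *m ys i + N s *m x + q2 s + (- c)).
  rewrite condED//; last exact: bounded_measurable_mx_cst.
  by rewrite condE_cst// condE_affine.
apply: sqnorm_condE_le => //.
  by apply: bounded_measurable_mxD => //; exact: bounded_measurable_mx_cst.
move=> s si; have [hM hN hq] := osc si it.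
have -> : M s *m ys i + N s *m x + q2 s - c =
    ((M s - M t) *m ys i + (N s - N t) *m x) + (q2 s - q2 t).
  by rewrite /c opprD addrACA; congr (_ + _); rewrite opprD addrACA !mulmxBl.
have hy : sqnorm ((M s - M t) *m ys i) <= eta * Cy.
  apply: le_trans (sqnorm_mulmx_le _ _) _.
  by apply: ler_pM; rewrite ?frob_ge0 ?sqnorm_ge0 ?yC.
have hx : sqnorm ((N s - N t) *m x) <= eta * Cx.
  apply: le_trans (sqnorm_mulmx_le _ _) _.
  by apply: ler_pM; rewrite ?frob_ge0 ?sqnorm_ge0 ?yC.
apply: le_trans (sqnormD_le _ _) _.
apply: (@le_trans _ _ (2 * (2 * (eta * Cy + eta * Cx) + eta))).
  rewrite ler_pM2l// lerD//; apply: le_trans (sqnormD_le _ _) _.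
  by rewrite ler_pM2l// lerD.
rewrite -subr_ge0 (_ : _ - _ = 2 * eta); first by rewrite mulr_ge0.
by rewrite /err; ring.
Qed.

(** The second-stage conditions of both problems are tested against each other at [t]. The residual
    [r] consumes half of the coercivity in [du t]; the part in [x - xs] stays whole. *)
Let pointwise_estimate i t : Xs i t -> (forall j, Xs j t -> j = i) ->
  k / 2 * sqnorm (du t) + (k * sqnorm (x - xs) - (2 * k)^-1 * err -
    dot (x - xs) (A *m (x - xs))) <= dot (x - xs) (B t *m du t).
Proof.
move=> it ui; have Xt := XsXi it.
have := compl_monotone (dsol.2 i) (recourseP q2 k0 coer xs Xt).
rewrite -(recourseXiE M N q2 xs Xt) -/y -(step_fun_cell ys it ui) -/(du t).
rewrite (step_fun_cell ys it ui).
set r := Md i *m ys i + Nd i *m x + qd i - (M t *m ys i + N t *m x + q2 t).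
rewrite (_ : _ - _ = (N t *m (x - xs) + M t *m du t) + r); last first.
  rewrite /r -/(Md i) -/(Nd i) -/(qd i) /du (step_fun_cell ys it ui).
  have lin (a b c d e q : 'cV[R]_m) :
      a - (b + c + q) = (d - c + (e - b)) + (a - (e + d + q)).
    by apply/colP => j; rewrite !mxE; ring.
  by rewrite !mulmxBr -lin.
rewrite dotDr => mono.
have := young (du t) (- r) k0; rewrite dotNr sqnormN => yg.
have := coer Xt (x - xs) (du t); rewrite (dotDr (x - xs)) => co.
have : (2 * k)^-1 * sqnorm r <= (2 * k)^-1 * err.
  by rewrite ler_pM2l ?residual_le// invr_gt0 mulr_gt0.
by lra.
Qed.

Let du_bounded : bounded_measurable_mx setT du.
Proof.
by apply: bounded_measurable_mxB; [exact: step_fun_bounded | exact: (recourseXi_bounded cXi cM cN cq2 k0 coer)].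
Qed.

Lemma sqnorm_error_bounded :
  bounded_measurable setT (fun t : borelRV R l => sqnorm (du t)).
Proof.
under eq_fun do rewrite sqnormE.
exact: bounded_measurable_dot.
Qed.

Lemma disc_estimate : k ^+ 2 * sqnorm (x - xs) <= err /\
  k ^+ 2 * \int[P]_t sqnorm (du t) <= err.
Proof.
set I := \int[P]_t sqnorm (du t).
have I0 : 0 <= I by apply: Rintegral_ge0 => t _; exact: sqnorm_ge0.
have s0 := sqnorm_ge0 (x - xs).
set c1 := k * sqnorm (x - xs) - (2 * k)^-1 * err - dot (x - xs) (A *m (x - xs)).
have bBdu : bounded_measurable_mx setT (fun t => B t *m du t).
  under [X in bounded_measurable_mx _ X]eq_fun do rewrite mulmxBr.
  apply: bounded_measurable_mxB; first exact: mul_step_fun_bounded.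
  exact: (mul_recourseXi_bounded cXi cB cM cN cq2 k0 coer).
have b1 : bounded_measurable setT (fun t : borelRV R l => k / 2 * sqnorm (du t)).
  apply: bounded_measurableM; last exact: sqnorm_error_bounded.
  exact: bounded_measurable_cst.
have i1 := bounded_measurable_integrable P measurableT b1.
have i2 := bounded_measurable_integrable P measurableT sqnorm_error_bounded.
have ic := bounded_measurable_integrable P measurableT
  (bounded_measurable_cst _ c1 : bounded_measurable (setT : set (borelRV R l)) _).
have : \int[P]_t (k / 2 * sqnorm (du t) + c1) <=
    \int[P]_t dot (x - xs) (B t *m du t).
  apply: le_Rintegral_ae => //.
  - apply: bounded_measurable_integrable => //.
    by apply: bounded_measurableD => //; exact: bounded_measurable_cst.
  - apply: bounded_measurable_integrable => //.
    by apply: bounded_measurable_dot => //; exact: bounded_measurable_mx_cst.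
  by apply: ae_imply ae_unique_cell => t [i it ui] _; exact: pointwise_estimate it ui.
rewrite RintegralD// RintegralZl// Rintegral_cst//.
rewrite (_ : fine _ = 1) ?mulr1; last exact: (congr1 fine (@probability_setT _ _ _ P)).
rewrite -dot_mxint//; last by move=> i; exact: bounded_measurable_mx_int.
rewrite (_ : mxint _ _ _ = \sum_i p i *: (Bd i *m ys i) -
    mxint P setT (fun t => B t *m y t)); last first.
  rewrite -mxint_mul_step_fun; apply/matrixP => a j; rewrite !mxE -RintegralB//.
  - by congr fine; apply: eq_integral => t _; rewrite mulmxBr !mxE.
  - exact: bounded_measurable_mx_int (mul_step_fun_bounded ys) a j.
  - exact: bounded_measurable_mx_int (mul_recourseXi_bounded cXi cB cM cN cq2 k0 coer xs) a j.
rewrite -/I /c1.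
(* First-stage complementarity makes the [A] term and the integrated [B] term together nonpositive,
   so only the residual remains on the right. *)
have := compl_monotone dsol.1 csol.2.2.1.
rewrite opprD addrACA subrr addr0 opprD addrACA -mulmxBr dotDr => h1 h2.
have h : k / 2 * I + k * sqnorm (x - xs) <= (2 * k)^-1 * err by lra.
have {}h : 2 * k * (k / 2 * I + k * sqnorm (x - xs)) <= err.
  by rewrite mulrC -ler_pdivlMr ?mulr_gt0// [leRHS]mulrC.
have k20 : 0 < k ^+ 2 by rewrite exprn_gt0.
have e1 : 2 * k * (k / 2 * I + k * sqnorm (x - xs)) =
    k ^+ 2 * I + 2 * (k ^+ 2 * sqnorm (x - xs)) by field.
have h3 := mulr_ge0 (ltW k20) s0; have h4 := mulr_ge0 (ltW k20) I0.
by split; lra.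
Qed.

End estimate.

End discretization.

(** * Transfer of the hypotheses to the support, and conclusion *)

Lemma frob_col (R : realType) n (u : 'cV[R]_n) : frob u = sqnorm u.
Proof. by apply: eq_bigr => i _; rewrite big_ord1. Qed.

Lemma continuous_dot (R : realType) l n (z : 'cV[R]_n) (h : 'rV[R]_l -> 'cV[R]_n) :
  (forall i, continuous (fun t => h t i 0)) -> continuous (fun t => dot z (h t)).
Proof.
move=> ch; apply: continuous_fun_sum => i.
by apply: continuous_funM => //; exact: cst_continuous.
Qed.

Lemma quadratic_formE (R : realType) n m (A : 'M[R]_n) (B : 'M[R]_(n, m))
    (N : 'M[R]_(m, n)) (M : 'M[R]_m) z u :
  ((col_mx z u)^T *m block_mx A B N M *m col_mx z u) 0 0 =
  dot z (A *m z + B *m u) + dot u (N *m z + M *m u).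
Proof.
rewrite -mulmxA mul_block_col tr_col_mx mul_row_col mxE.
by rewrite !mxE; congr (_ + _); apply: eq_bigr => i _; rewrite mxE.
Qed.

Lemma frob_oscillation (R : realType) l m n (D : set 'rV[R]_l)
    (H : 'rV[R]_l -> 'M[R]_(m, n)) (eta : R) :
  compact D -> continuous H -> 0 < eta ->
  exists2 r, 0 < r & forall x y, D x -> ball x r y -> frob (H x - H y) <= eta.
Proof.
(* The [+ 1] keeps the divisor positive for matrices without entries. Each entry may oscillate by
   the square root of [eta / c]. *)
move=> cD cH eta0; set c := (m * n)%:R + 1 : R.
have c0 : 0 < c by rewrite ltr_wpDl ?ler0n.
pose e := Num.sqrt (eta / c).
have e0 : 0 < e by rewrite sqrtr_gt0 divr_gt0.
have [r r0 rH] := compact_unif_continuous cD cH e0.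
exists r => // x y Dx xy.
apply: le_trans (@frob_le_card _ _ _ _ (e ^+ 2) _) _.
  move=> i j; have [_ /(_ i j)] := rH x y Dx xy.
  rewrite /ball/= /ball_/= => h; rewrite !mxE -real_normK ?num_real//.
  by rewrite lerXn2r ?nnegrE ?(ltW e0)// ltW.
rewrite sqr_sqrtr ?divr_ge0 ?(ltW eta0) ?(ltW c0)// mulrA ler_pdivrMr//.
by rewrite mulrC ler_wpM2l ?(ltW eta0)// lerDl.
Qed.

(** With [z] and [u] fixed, the difference of the two sides is continuous in the parameter, so
    [supp_ae_ge0] applies. *)
Lemma supp_coercive (R : realType) (n m l : nat)
  (P : probability (borelRV R l) R) (A : 'M[R]_n) (B : 'rV[R]_l -> 'M[R]_(n, m))
  (M : 'rV[R]_l -> 'M[R]_m) (N : 'rV[R]_l -> 'M[R]_(m, n)) (kappa : 'rV[R]_l -> R) :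
  continuous B -> continuous M -> continuous N -> continuous kappa ->
  {ae P, forall xi : borelRV R l, forall (z : 'cV[R]_n) (u : 'cV[R]_m),
     kappa xi * (sqnorm z + sqnorm u) <=
     ((col_mx z u)^T *m block_mx A (B xi) (N xi) (M xi) *m col_mx z u) 0 0} ->
  forall t, supp P t -> forall z u, kappa t * (sqnorm z + sqnorm u) <=
    dot z (A *m z + B t *m u) + dot u (N t *m z + M t *m u).
Proof.
move=> cB cM cN ck h t Pt z u.
pose g s := dot z (A *m z + B s *m u) + dot u (N s *m z + M s *m u) +
  kappa s * - (sqnorm z + sqnorm u).
suff : 0 <= g t by rewrite /g mulrN subr_ge0.
apply: supp_ae_ge0 Pt; last first.
  by apply: ae_imply h => s /(_ z u); rewrite quadratic_formE /g mulrN subr_ge0.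
apply: continuous_funD; last first.
  by apply: continuous_funM => //; exact: cst_continuous.
apply: continuous_funD; apply: continuous_dot => i; under eq_fun do rewrite mxE.
  apply: continuous_funD; first exact: cst_continuous.
  exact: continuous_coord_mulmx.
by apply: continuous_funD; exact: continuous_coord_mulmx.
Qed.

Lemma compact_positive_min (R : realType) l (D : set 'rV[R]_l) (f : 'rV[R]_l -> R) :
  compact D -> continuous f -> (forall x, 0 < f x) ->
  exists2 k, 0 < k & forall x, D x -> k <= f x.
Proof.
move=> cD cf f0; have [[a Da]|D0] := pselect (D !=set0); last first.
  by exists 1 => // x Dx; case: D0; exists x.
have D0 : D !=set0 by exists a.
have [|c _ fc] := compact_EVT_min D0 cD (f := f).
  exact: continuous_subspaceT.
by exists (f c) => // x Dx; apply: fc; exact: mem_set.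
Qed.

Theorem theorem3p1 (R : realType) (n m l : nat)
  (P : probability (borelRV R l) R) (Xi : set 'rV[R]_l)
  (A : 'M[R]_n) (q1 : 'cV[R]_n) (B : 'rV[R]_l -> 'M[R]_(n, m))
  (M : 'rV[R]_l -> 'M[R]_m) (N : 'rV[R]_l -> 'M[R]_(m, n))
  (q2 : 'rV[R]_l -> 'cV[R]_m) (kappa : 'rV[R]_l -> R)
  (Xs : forall K : nat, 'I_K -> set 'rV[R]_l) :
  supp P = Xi -> compact Xi -> convex_set (Xi : set 'rV[R]_l) ->
  continuous B -> continuous M -> continuous N -> continuous q2 ->
  continuous kappa -> (forall xi, 0 < kappa xi) ->
  (\int[P]_xi (kappa xi)%:E < +oo)%E ->
  {ae P, forall xi : borelRV R l, forall (z : 'cV[R]_n) (u : 'cV[R]_m),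
     kappa xi * (sqnorm z + sqnorm u) <=
     ((col_mx z u)^T *m block_mx A (B xi) (N xi) (M xi) *m col_mx z u) 0 0} ->
  (forall K : nat, (0 < K)%N ->
     (forall i, compact (Xs K i)) /\ (forall i, convex_set (Xs K i : set 'rV[R]_l)) /\
     (forall i j, i != j -> interior (Xs K i) `&` interior (Xs K j) = set0) /\
     (forall i j, i != j -> P (Xs K i `&` Xs K j) = 0%E) /\
     \bigcup_(i in [set: 'I_K]) Xs K i = Xi /\
     (forall i, (0 < P (Xs K i))%E)) ->
  (* (i) *)
  (forall K : nat, (0 < K)%N ->
     exists (x : 'cV[R]_n) (ys : 'I_K -> 'cV[R]_m),
       disc_sol P A q1 B M N q2 (Xs K) x ys /\
       forall x' ys', disc_sol P A q1 B M N q2 (Xs K) x' ys' ->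
         x' = x /\ forall i, ys' i = ys i)
  /\
  ((fun K => \big[Order.max/0]_(i < K) diam (Xs K i)) @ \oo --> (0 : R) ->
   forall (xK : nat -> 'cV[R]_n) (yK : forall K : nat, 'I_K -> 'cV[R]_m),
   (forall K : nat, (0 < K)%N -> disc_sol P A q1 B M N q2 (Xs K) (xK K) (yK K)) ->
   let yf (K : nat) (xi : 'rV[R]_l) : 'cV[R]_m :=
     \sum_(i < K) \1_(Xs K i) xi *: yK K i in
   (* (ii) *)
   (exists C : R, forall K : nat, (0 < K)%N ->
      enorm (xK K) <= C /\
      (\int[P]_xi (enorm (yf K xi))%:E <= C%:E)%E)
   /\
   (* (iii) *)
   (exists (xs : 'cV[R]_n) (ys : 'rV[R]_l -> 'cV[R]_m),
      slcp_sol P A q1 B M N q2 xs ys /\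
      (forall x' y', slcp_sol P A q1 B M N q2 x' y' ->
         x' = xs /\ {ae P, forall xi : borelRV R l, y' xi = ys xi}) /\
      xK @ \oo --> xs /\
      (fun K => (\int[P]_xi (sqnorm (yf K xi - ys xi))%:E)%E) @ \oo --> 0%E)).

Proof.
move=> PXi cXi _ cB cM cN cq2 ck kappa0 _ coer hpart.
have XiP : P.-negligible (~` Xi) by rewrite -PXi; exact: supp_full.
have [k k0 kkappa] := compact_positive_min cXi ck kappa0.
have {}coer t : Xi t -> forall z u, k * (sqnorm z + sqnorm u) <=
    dot z (A *m z + B t *m u) + dot u (N t *m z + M t *m u).
  move=> Xt z u; apply: le_trans (supp_coercive cB cM cN ck coer _ z u).
    by rewrite ler_wpM2r ?addr_ge0 ?sqnorm_ge0// kkappa.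
  by rewrite PXi.
split.
  move=> K /hpart[cXs [_ [_ [Xs0 [XsU PXs]]]]].
  exact: (disc_exists_unique q1 q2 XiP cB cM cN k0 coer cXs Xs0 XsU PXs).
move=> diam0 xK yK dsol yf.
have [b b0 [_ Nb]] := compact_frob_bound cXi cB cN.
have [c q2c] : exists c, forall t, Xi t -> sqnorm (q2 t) <= c.
  have [c hc] := frob_compact_bounded cXi cq2.
  by exists c => t /hc; rewrite frob_col.
have k20 : 0 < k ^+ 2 by rewrite exprn_gt0.
pose Cx := (c + sqnorm q1) / k ^+ 2.
pose Cy := 2 * (b * Cx + c) / k ^+ 2.
have bounds K : (0 < K)%N -> sqnorm (xK K) <= Cx /\ forall i, sqnorm (yK K i) <= Cy.
  move=> K0; have [cXs [_ [_ [Xs0 [XsU PXs]]]]] := hpart K K0.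
  have [hx hy] := disc_bound XiP cB cM cN cq2 k0 coer cXs Xs0 XsU PXs
    Nb q2c (dsol K K0).
  have xC : sqnorm (xK K) <= Cx by rewrite ler_pdivlMr// mulrC.
  split => // i; rewrite ler_pdivlMr// mulrC (le_trans (hy i))//.
  by rewrite ler_pM2l// lerD2r ler_wpM2l.
split.
  (* The bound on [yf K] is uniform almost everywhere, and under a probability this bounds the
     integral by the same constant. *)
  exists (Num.max (Num.sqrt Cx) (Num.sqrt Cy)) => K K0.
  have [xC yC] := bounds K K0.
  have [cXs [_ [_ [Xs0 [XsU PXs]]]]] := hpart K K0.
  split; first by rewrite le_max ler_wsqrtr.
  set C := Num.max _ _.
  have C0 : 0 <= C by rewrite le_max sqrtr_ge0.
  rewrite -[leRHS]mule1 -(probability_setT P) -integral_cst//.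
  apply: ae_ge0_le_integral => //.
  - by move=> t _; rewrite lee_fin sqrtr_ge0.
  - apply/measurable_EFinP; apply: measurableT_comp.
      by apply: continuous_measurable_fun; exact: sqrt_continuous.
    under eq_fun do rewrite sqnormE.
    by apply: (bounded_measurable_dot _ _).1; exact: step_fun_bounded.
  apply: ae_imply (ae_unique_cell XiP cXs Xs0 XsU) => t [i it ui] _.
  have -> : yf K t = yK K i := step_fun_cell (yK K) it ui.
  by rewrite lee_fin le_max; apply/orP; right; apply: ler_wsqrtr.
have [xs csol cuniq] := slcp_exists_unique q1 XiP cXi cB cM cN cq2 k0 coer.
exists xs, (recourseXi Xi M N q2 xs); split => //; split => //.
set y := recourseXi Xi M N q2 xs.
have error e : 0 < e -> \forall K \near \oo, (0 < K)%N /\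
    sqnorm (xK K - xs) <= e /\ \int[P]_t sqnorm (yf K t - y t) <= e.
  move=> e0.
  (* The bound at [K = 1] shows that [Cx] is nonnegative; for [Cy] the maximum with 0 settles the
     sign. *)
  have [xC yC] : 0 <= Cx /\ 0 <= Num.max 0 Cy.
    by split; rewrite ?le_max ?lexx// (le_trans (sqnorm_ge0 (xK 1))) ?(bounds 1%N _).1.
  set C := 4 * (Cx + Num.max 0 Cy + 1).
  have C0 : 0 < C by rewrite mulr_gt0// ltr_wpDl// addr_ge0.
  (* Chosen so that the right-hand side of [disc_estimate], [C * eta], equals [k ^+ 2 * e]. *)
  pose eta := k ^+ 2 * e / C.
  have eta0 : 0 < eta by rewrite divr_gt0// mulr_gt0.
  have [rM rM0 hM] := frob_oscillation cXi cM eta0.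
  have [rN rN0 hN] := frob_oscillation cXi cN eta0.
  have [rq rq0 hq] := frob_oscillation cXi cq2 eta0.
  pose r := Num.min rM (Num.min rN rq).
  have r0 : 0 < r by rewrite !lt_min rM0 rN0.
  have diamr : \forall K \near \oo, \big[Order.max/0]_(i < K) diam (Xs K i) < r.
    by have /cvgr_lt := diam0; exact.
  have K0 : \forall K \near \oo, (0 < K)%N by exact: nbhs_infty_gt.
  apply: filterS2 K0 diamr => K K0 Kr; split => //.
  have [cXs [_ [_ [Xs0 [XsU PXs]]]]] := hpart K K0.
  have [xCK yCK] := bounds K K0.
  have yCK' i : sqnorm (yK K i) <= Num.max 0 Cy by rewrite le_max yCK orbT.
  have osc i s t : Xs K i s -> Xs K i t ->
      [/\ frob (M s - M t) <= eta, frob (N s - N t) <= eta &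
          sqnorm (q2 s - q2 t) <= eta].
    move=> si ti.
    have st : ball s r t.
      apply: (diam_ball (cXs i) si ti); apply: le_lt_trans Kr.
      exact: (le_bigmax 0 (fun i => diam (Xs K i)) i).
    have Xis : Xi s by rewrite -XsU; exists i.
    split; [apply: hM | apply: hN | rewrite -frob_col; apply: hq] => //;
      by apply: le_ball st; rewrite !ge_min lexx ?orbT.
  have [hx hy] := disc_estimate XiP cXi cB cM cN cq2 k0 coer cXs Xs0 XsU PXs
    (dsol K K0) csol xCK yCK' (ltW eta0) osc.
  have Ceta : C * eta = k ^+ 2 * e by rewrite mulrC divfK// gt_eqF.
  by split; rewrite -(ler_pM2l k20) -Ceta.
split.
  (* The error is controlled in squared Euclidean norm, which dominates the squared sup norm; hence
     the tolerance [e ^+ 2]. *)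
  apply/cvgrPdist_le => e e0; apply: filterS (error _ (exprn_gt0 2 e0)) => K [_ [xe _]].
  rewrite distrC -(@ler_pXn2r _ 2) ?nnegrE ?(ltW e0)//.
  exact: le_trans (norm_sqr_le_sqnorm _) xe.
apply/fine_cvgP; split.
  apply: filterS (error 1 ltr01) => K [K0 _].
  apply: integrable_fin_num => //; apply: bounded_measurable_integrable => //.
  have [cXs _] := hpart K K0.
  exact: (sqnorm_error_bounded cXi cM cN cq2 k0 coer cXs).
apply/cvgrPdist_le => e e0; apply: filterS (error e e0) => K [_ [_ ye]].
rewrite sub0r normrN ger0_norm//.
by apply: Rintegral_ge0 => t _; exact: sqnorm_ge0.
Qed.
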